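(* Let $p$ be a family of transition probabilities on $A=\{1,\dots,\mathcal K\}$ that satisfies the non-nullness condition and is continuous, and let $\mathbb P$ be a stationary ergodic probability measure on $A^{\mathbb Z}$, without atoms and invariant with respect to $p$. Let $h$, $\mathscr Q$ and $T=h\circ\mathscr S\circ h^{-1}$ (on $\Omega\setminus h(\mathscr Q)$, $\Omega=[0,1]$) be as defined in the context. Then: (1) The map $T$ can be continuously extended to a monotone increasing map on each interval $I_j=(\eta_{j-1},\eta_j)$, $j=1,\dots,\mathcal K$, with end points $0=\eta_0<\eta_1<\dots<\eta_{\mathcal K}=1$ where $\eta_k=h(\mathcal K_{-\infty}^{-1}k)=h(1_{-\infty}^{-1}(k+1))$ for $k=1,\dots,\mathcal K-1$. (2) The extended map (also denoted $T$) is a topological Markov map, and the Lebesgue measure $\lambda$ on $\Omega$ is invariant by $T$ and ergodic. Moreover the regular versions of the conditional probabilities associated to the sequence of dynamical partitions are given by $p$; that is, for each $b\in A$, $\lambda\big(W_0=b\,\big|\,\sigma(W_1,W_2,\dots)\big)(\omega)=p\big(b\,\big|\,\dots,W_2(\omega),W_1(\omega)\big)$ for $\lambda$-almost every $\omega$, where $W_n(\omega)=j$ if $T^n(\omega)\in I_j$. (3) $T$ is differentiable outside $h(\mathscr Q)$, and for each $\omega\in\Omega\setminus h(\mathscr Q)$ $$T'(\omega)=\frac{1}{p\big(h^{-1}(\omega)_0\,\big|\,h^{-1}(\omega)_{-\infty}^{-1}\big)},$$ where $h^{-1}(\omega)_{-\infty}^{0}$ denotes the successive elements of the sequence $h^{-1}(\omega)\in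 A_{-\infty}^0$. (4) Let $\omega\in h(\mathscr Q)$. If $\omega=h\big(\mathcal K_{-\infty}^{-(k+2)}\,a\,z_{-k}^0\big)=h\big(1_{-\infty}^{-(k+2)}\,(a+1)\,z_{-k}^0\big)$ for some $a\in\{1,\dots,\mathcal K-1\}$, some integer $k\ge 0$ and some $z_{-k}^0\in A_{-k}^0$, then the left and right derivatives of $T$ at $\omega$ exist and are equal respectively to $$\frac{1}{p\big(z_0\,\big|\,\mathcal K_{-\infty}^{-(k+2)}\,a\,z_{-k}^{-1}\big)}\quad\text{and}\quad\frac{1}{p\big(z_0\,\big|\,1_{-\infty}^{-(k+2)}\,(a+1)\,z_{-k}^{-1}\big)} .$$ If $\omega=h(\mathcal K_{-\infty}^{-1}a)=h(1_{-\infty}^{-1}(a+1))=\eta_a$ for some $a\in\{1,\dots,\mathcal K-1\}$ (the case $k=-1$), then the left and right derivatives at $\omega$ (of the continuous extensions of $T|_{I_a}$ and $T|_{I_{a+1}}$ to $\overline{I_a}$ and $\overline{I_{a+1}}$, respectively) exist and are equal respectively to $1/p(a\,|\,\mathcal K_{-\infty}^{-1})$ and $1/p(a+1\,|\,1_{-\infty}^{-1})$. (5) In particular, if for every $a\in\{1,\dots,\mathcal K-1\}$, every integer $k\ge0$ and every $z_{-k}^0\in A_{-k}^0$ we have $$p\big(z_0\,\big|\,\mathcal K_{-\infty}^{-(k+2)}\,a\,z_{-k}^{-1}\big)=p\big(z_0\,\big|\,1_{-\infty}^{-(k+2)}\,(a+1)\,z_{-k}^{-1}\big),\qquad(\ast)$$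 then $T$ is piecewise $C^1$. (6) If the continuity rate $\beta_k$ decays exponentially fast (there are $C>0$, $0<\rho<1$ with $\beta_k\le C\rho^k$ for all $k\ge1$) and the equalities $(\ast)$ hold, then $T$ is piecewise $C^{1+\alpha}$, for some $\alpha>0$ which depends on the exponential rate of decay of $\beta_k$.
   Context: Notation. $A=\{1,\dots,\mathcal K\}$ is a finite alphabet. For $m\le n$, $w_m^n=(w_m,\dots,w_n)$ is a sequence of symbols of $A$, and $A_m^n$ is the set of such sequences; $m=-\infty$ is allowed; if $m>n$ the string is empty. Concatenation is written by juxtaposition (rightmost symbols are at the most recent positions); e.g. $z_{-\infty}^{-1}a\in A_{-\infty}^0$ has $a$ at position $0$ and $z_i$ at positions $i\le-1$. The same notation is used for a sequence in $A_{-\infty}^{-1}$ and its translates in position. $\mathcal K_{-\infty}^{m}$ and $1_{-\infty}^{m}$ denote the left-infinite sequences (positions $\le m$) identically equal to $\mathcal K$ and $1$. In a conditioning past $p(b|\cdot)$, a left-infinite sequence is regarded as an element of $A_{-\infty}^{-1}$. Transition probabilities. A family of transition probabilities is a family $p(a|x_{-\infty}^{-1})\in[0,1]$, $a\in A$, $x_{-\infty}^{-1}\in A_{-\infty}^{-1}$, with $\sum_a p(a|x_{-\infty}^{-1})=1$ and $x_{-\infty}^{-1}\mapsto p(a|x_{-\infty}^{-1})$ measurable for the product $\sigma$-algebra. It is non-null if $\inf\{p(a|x_{-\infty}^{-1}): a\in A,\ x_{-\infty}^{-1}\in A_{-\infty}^{-1}\}>0$. Its continuity rate is $\beta_k=\sup\{|p(a|x_{-\infty}^{-1})-p(a|y_{-\infty}^{-1})|: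 a\in A,\ x_{-k}^{-1}=y_{-k}^{-1}\}$, $k\ge1$; $p$ is continuous if $\beta_k\to0$. A probability $\mathbb P$ on $A^{\mathbb Z}$ is stationary if it is invariant under the shift; it is invariant with respect to $p$ if for every continuous $f:A_{-\infty}^0\to\mathbb R$, $\int f(z_{-\infty}^0)\,d\mathbb P(z_{-\infty}^0)=\int\sum_{a\in A}p(a|z_{-\infty}^{-1})f(z_{-\infty}^{-1}a)\,d\mathbb P(z_{-\infty}^{-1})$. $\mathbb P$ is also used for its marginals on $A_{-\infty}^0$ and $A_{-\infty}^{-1}$. The map. The shift is $\mathscr S(z)_i=z_{i-1}$; on $A_{-\infty}^0$ it is $(\mathscr S x)_i=x_{i-1}$, $i\le0$ (it removes $x_0$). The lexicographic order on $A_{-\infty}^0$ is: $x_{-\infty}^0<y_{-\infty}^0$ if for some $m\ge0$, $x_{-(m-1)}^0=y_{-(m-1)}^0$ and $x_{-m}<y_{-m}$. Put $J(x_{-\infty}^0)=\{y_{-\infty}^0: y_{-\infty}^0\le x_{-\infty}^0\}$ and $h:A_{-\infty}^0\to\Omega=[0,1]$, $h(x_{-\infty}^0)=\mathbb P(J(x_{-\infty}^0))$. The exceptional countable set $\mathscr Q\subset A_{-\infty}^0$ consists of all sequences $\mathcal K_{-\infty}^{-1}j$, $1_{-\infty}^{-1}(j+1)$ and $\mathcal K_{-\infty}^{-(k+2)}jx_{-k}^0$, $1_{-\infty}^{-(k+2)}(j+1)x_{-k}^0$ with $1\le j\le\mathcal K-1$, $k\ge0$, $x_{-k}^0\in A_{-k}^0$.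 Every point of $\Omega\setminus h(\mathscr Q)$ has exactly one preimage under $h$, and $T$ is defined on $\Omega\setminus h(\mathscr Q)$ by $T=h\circ\mathscr S\circ h^{-1}$. A map $T$ of $\Omega$, defined outside $\{\eta_0,\dots,\eta_{\mathcal K}\}$ and monotone on each $I_j$, is called topological Markov if for each $i$ the closure of $T(I_i)$ is a union of closures of intervals $I_j$. Piecewise $C^1$ (resp. $C^{1+\alpha}$) means that for each $j$ the restriction of $T$ to $I_j$ extends to a $C^1$ map on $\overline{I_j}$ (resp. a $C^1$ map with $\alpha$-Hölder derivative). Since $T$ lives on $[0,1]$, derivatives at $0$ and $1$ are one-sided. *)

(* Defs.v *)
From HB Require Import structures.
From mathcomp Require Import all_boot all_order all_algebra.
From mathcomp Require Import all_classical all_reals all_analysis.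

Set Implicit Arguments.
Unset Strict Implicit.
Unset Printing Implicit Defensive.

Import Order.TTheory GRing.Theory Num.Theory.
Import numFieldNormedType.Exports.

Local Open Scope classical_set_scope.
Local Open Scope ring_scope.

(* The alphabet {1, ..., K} is 'I_n.+1 with K = n.+1, the symbol j being       *)
(* represented by j - 1. Thus 1 is ord0 and K is ord_max, and for a in         *)
(* {1, ..., K - 1}, represented by a : 'I_n, the two consecutive symbols a and *)
(* a + 1 are sym a and symS a.                                                 *)
Definition sym n (a : 'I_n) : 'I_n.+1 := widen_ord (leqnSn n) a.
Definition symS n (a : 'I_n) : 'I_n.+1 := lift ord0 a.

(* Generated sigma-algebras are only instances over pointed types. *)
HB.instance Definition _ n := isPointed.Build 'I_n.+1 ord0.

(* Elements of A^I with the product sigma-algebra, generated by the sets       *)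
(* {x | x i = a}.                                                              *)
Definition coord_sets (I : Type) n : set (set (I -> 'I_n.+1)) :=
  [set B | exists i a, B = [set x | x i = a]].
Definition words (I : Type) n := g_sigma_algebraType (@coord_sets I n).

(* Left-infinite sequences are read backwards: x i is the symbol sitting i     *)
(* places to the left of the last one. Hence x : past n represents both the    *)
(* element of A_{-oo}^0 with x_{-i} = x i and its translate in A_{-oo}^{-1}    *)
(* with x_{-1-i} = x i.                                                        *)
Notation past n := (words nat n).

Definition push n (a : 'I_n.+1) (x : past n) : past n :=
  fun i => if i is j.+1 then x j else a.

(* pushs [:: s_0; ...; s_k] x is the sequence  ... x 1, x 0, s_k, ..., s_0.    *)
Definition pushs n (s : seq 'I_n.+1) (x : past n) : past n := foldr (@push n) x s.

Definition drop_last n (x : past n) : past n := fun i => x i.+1.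

Definition allmin n : past n := fun=> ord0.
Definition allmax n : past n := fun=> ord_max.

(* For s = [:: z_0; ...; z_{-k}] these are the sequences K_{-oo} a z_{-k}^0    *)
(* and 1_{-oo} (a+1) z_{-k}^0; for s = [::] they are K_{-oo} a, 1_{-oo} (a+1). *)
Definition below n (a : 'I_n) (s : seq 'I_n.+1) : past n :=
  pushs (rcons s (sym a)) (allmax n).
Definition above n (a : 'I_n) (s : seq 'I_n.+1) : past n :=
  pushs (rcons s (symS a)) (allmin n).

Definition exceptional n : set (past n) :=
  [set x | exists a s, x = below a s \/ x = above a s].

Definition lexlt n (x y : past n) : Prop :=
  exists m, (forall i, (i < m)%N -> x i = y i) /\ (x m < y m)%N.
Definition lexle n (x y : past n) : Prop := x = y \/ lexlt x y.

Section Transitions.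
Context {R : realType} {n : nat}.
Implicit Type p : 'I_n.+1 -> past n -> R.

Definition transition_family p : Prop :=
  [/\ forall a x, 0 <= p a x <= 1,
      forall x, \sum_a p a x = 1
    & forall a, measurable_fun setT (p a)].

Definition non_null p : Prop :=
  0 < inf [set r : R | exists a x, r = p a x].

Definition continuity_rate p (k : nat) : R :=
  sup [set r : R | exists a x y,
    (forall i, (i < k)%N -> x i = y i) /\ r = `|p a x - p a y|].

Definition continuous_family p : Prop := continuity_rate p @ \oo --> (0 : R).

End Transitions.

Section Processes.
Context {R : realType} {n : nat}.
Implicit Types (P : probability (words int n) R) (p : 'I_n.+1 -> past n -> R).

Definition word_shift (z : words int n) : words int n := fun i => z (i - 1).

Definition past0 (z : words int n) : past n := fun i => z (- i%:Z).
Definition past1 (z : words int n) : past n := fun i => z (- i.+1%:Z).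

Definition stationary P : Prop :=
  forall B, measurable B -> P (word_shift @^-1` B) = P B.

Definition shift_ergodic P : Prop :=
  forall B, measurable B -> word_shift @^-1` B = B -> P B = 0%E \/ P B = 1%E.

Definition atomless P : Prop := forall z, P [set z] = 0%E.

Definition invariant_wrt P p : Prop :=
  forall f : prod_topology (fun _ : nat => discrete_topology 'I_n.+1) -> R,
    continuous f ->
    (\int[P]_z (f (past0 z))%:E =
     \int[P]_z (\sum_a p a (past1 z) * f (push a (past1 z)))%:E)%E.

Definition h P (x : past n) : R :=
  fine (P [set z | lexle (past0 z) x]).

(* hinv and T0 = h o S o h^{-1} are only meaningful at the points of [0, 1]    *)
(* outside h @` exceptional n, which have exactly one preimage under h.        *)
Definition hinv P : R -> past n := 'pinv_(fun=> allmin n) setT (h P).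
Definition T0 P : R -> R := h P \o @drop_last n \o hinv P.

Definition eta P (k : nat) : R :=
  if k == 0%N then 0 else if k == n.+1 then 1 else
  h P (push (inord k.-1) (allmax n)).

Definition branch P (j : 'I_n.+1) : set R := `]eta P j, eta P j.+1[.
Definition branch_closure P (j : 'I_n.+1) : set R := `[eta P j, eta P j.+1].

End Processes.

Section IntervalMaps.
Context {R : realType}.
Implicit Types (T g : R -> R) (D I : set R).

Definition Omega : set R := `[0, 1].

Definition diff_quotient g (x y : R) : R := (g y - g x) / (y - x).

(* Derivative of g at x relative to D: the usual derivative when x is interior *)
(* to D, and a one-sided derivative when x is an end point of an interval D.   *)
Definition deriv_within D g (x l : R) : Prop :=
  diff_quotient g x @ within D x^' --> l.
Definition left_deriv g (x l : R) : Prop := diff_quotient g x @ x^'- --> l.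
Definition right_deriv g (x l : R) : Prop := diff_quotient g x @ x^'+ --> l.

Lemma deriv_within_interior D g (x l : R) : nbhs x D ->
  deriv_within D g x l <-> is_derive x 1 g l.
Proof.
move=> [d /= d0 dD].
have quotE k : diff_quotient g x (k + x) = k^-1 *: (g (k *: 1 + x) - g x).
  by rewrite /diff_quotient addrK mulrC -[k *: 1]/(k * 1) mulr1.
have -> : is_derive x 1 g l <->
    k^-1 *: (g (k *: 1 + x) - g x) @[k --> 0^'] --> l.
  split=> [[dg <-]|gl]; first exact: dg.
  by apply: DeriveDef; [apply/cvg_ex; exists l|apply: cvg_lim].
rewrite /deriv_within; split=> /cvgrPdist_lt gl; apply/cvgrPdist_lt => e e0.
  have [r /= r0 rP] := gl e e0.
  exists (Num.min d r) => /=; first by rewrite lt_min d0.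
  move=> k /=; rewrite sub0r normrN lt_min => /andP[kd kr] k0.
  rewrite -quotE.
  have xk : `|x - (k + x)| = `|k| by rewrite opprD addrCA subrr addr0 normrN.
  apply: rP; rewrite /= ?xk//; first by rewrite -subr_eq0 addrK.
  by apply: dD; rewrite /= xk.
have [r /= r0 rP] := gl e e0.
exists r => // y /= xyr yx Dy.
have := rP (y - x); rewrite -quotE subrK; apply; last by rewrite subr_eq0.
by rewrite /= sub0r normrN distrC.
Qed.

Definition topological_markov (J : finType) (I : J -> set R) T : Prop :=
  [/\ forall j x, I j x -> Omega (T x),
      forall j, {in I j &, {homo T : x y / x <= y}} \/
                {in I j &, {homo T : x y /~ x <= y}}
    & forall i, exists S : {set J},
        closure (T @` I i) = \bigcup_(j in [set` S]) closure (I j)].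

(* Lebesgue measure on Omega, for a map T whose domain D has full measure. *)
Definition lebesgue_invariant D T : Prop :=
  forall B, measurable B -> B `<=` Omega ->
    measurable (D `&` T @^-1` B) /\
    lebesgue_measure (D `&` T @^-1` B) = lebesgue_measure B.

Definition lebesgue_ergodic D T : Prop :=
  forall B, measurable B -> B `<=` Omega ->
    lebesgue_measure ((D `&` T @^-1` B) `+` B) = 0%E ->
    lebesgue_measure B = 0%E \/ lebesgue_measure B = 1%E.

(* q is a version of the conditional probability lambda(E | G), lambda being   *)
(* the Lebesgue measure on Omega and G a sub-sigma-algebra of its Borel sets.  *)
Definition conditional_prob_version (E : set R) (G : set (set R)) (q : R -> R)
    : Prop :=
  [/\ G `<=` measurable,
      forall Y, measurable Y -> G (Omega `&` q @^-1` Y)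
    & forall B, G B ->
        (\int[lebesgue_measure]_(w in B) (q w)%:E =
         lebesgue_measure (B `&` E))%E].

Definition C1_on (a b : R) g (g' : R -> R) : Prop :=
  (forall x, a <= x <= b -> deriv_within `[a, b] g x (g' x)) /\
  {within `[a, b], continuous g'}.

Definition holder_on (a b alpha : R) g' : Prop :=
  exists C : R, forall x y, a <= x <= b -> a <= y <= b ->
    `|g' x - g' y| <= C * `|x - y| `^ alpha.

End IntervalMaps.

Section ExtendedMap.
Context {R : realType} {n : nat}.
Implicit Types (P : probability (words int n) R) (T g : R -> R).

Definition continuous_extension P T : Prop :=
  (forall w, Omega w -> ~ (h P @` @exceptional n) w -> T w = T0 P w) /\
  (forall j, {within branch P j, continuous T}).

Definition branches P : set R := \bigcup_j branch P j.

(* W_n(w) = j if T^n w lies in I_j; the value is irrelevant on the countable   *)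
(* set where T^n w is undefined or an end point.                               *)
Definition itinerary P T (k : nat) (w : R) : 'I_n.+1 :=
  xget ord0 [set j | branch P j (iter k T w)].

(* sigma(W_1, W_2, ...) on Omega. *)
Definition future_algebra P T : set (set R) :=
  <<s Omega, [set B | exists k a,
     B = Omega `&` [set w | itinerary P T k.+1 w = a]] >>.

Definition branch_extension P T (j : 'I_n.+1) g : Prop :=
  {in branch P j, g =1 T} /\ {within branch_closure P j, continuous g}.

Definition piecewise_C1 P T : Prop :=
  forall j, exists g g', {in branch P j, g =1 T} /\
    C1_on (eta P j) (eta P j.+1) g g'.

Definition piecewise_C1_holder P (alpha : R) T : Prop :=
  forall j, exists g g', [/\ {in branch P j, g =1 T},
    C1_on (eta P j) (eta P j.+1) g g'
    & holder_on (eta P j) (eta P j.+1) alpha g'].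

(* z0 stands for z_0 and w lists z_{-1}, ..., z_{-k}, k being its size. *)
Definition matching (p : 'I_n.+1 -> past n -> R) : Prop :=
  forall (a : 'I_n) (z0 : 'I_n.+1) (w : seq 'I_n.+1),
    p z0 (below a w) = p z0 (above a w).

End ExtendedMap.

(* Main.v *)
From HB Require Import structures.
Require Import Defs.
From mathcomp Require Import all_boot all_order all_algebra.
From mathcomp Require Import all_classical all_reals all_analysis.
From mathcomp Require Import measurable_realfun ring lra.

Set Implicit Arguments.
Unset Strict Implicit.
Unset Printing Implicit Defensive.

Import Order.TTheory GRing.Theory Num.Theory.
Import numFieldNormedType.Exports.

Local Open Scope classical_set_scope.
Local Open Scope ring_scope.

(** The conditional structure of the process becomes a statement about slopes
    once everything is expressed through the law mu of the past (past_law) and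
    its distribution function h for the lexicographic order.

    By stationarity and invariance, extended from clopen sets to all
    measurable sets, mu has the one-step disintegration (past_law_push): the
    pasts ending with a whose remainder lies in B have mass the integral of
    p(a | .) over B with respect to mu. If d is the infimum of p, then p takes
    values in [d, 1 - d], so that a cylinder of length m has mass between d^m
    and (1 - d)^m (mass_cyl). The upper bound shows that mu has no atoms, that
    h is onto [0, 1] and that h maps mu to the Lebesgue measure (cdf_onto,
    cdf_law). The lower bound shows that h identifies two pasts only if no
    cylinder lies between them, that is, if they are consecutive for the order
    (cdf_inj); these pairs make up the exceptional set.

    Prepending the symbol j is increasing, and by the disintegration it sends
    an increment h(y) - h(x) to the integral of p(j | .) over the interval
    between x and y (cdf_push_between). Hence h(x) is an increasing Lipschitz
    function of h(jx): this is branch_map j, and it is the only continuous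
    choice for T on the interval number j since h of the exceptional set is
    countable (extension_branch). The difference quotients of T are inverses of
    mean values of p(j | .) over small intervals of pasts
    (diff_quotient_branch). An interval that shrinks to h(x) from the left,
    resp. from the right, consists of pasts that agree with x on more and more
    symbols, provided that x is not eventually minimal, resp. maximal
    (agree_left, agree_right). Continuity of p then gives the derivatives off
    the exceptional set and, applied to the two members of a consecutive pair,
    the one-sided derivatives on it.

    If p(j | .) takes the same value at the members of each pair, it factors
    through h, the factor is continuous and so is the derivative
    (matching_continuous, branch_C1). When moreover the continuity rate is at
    most C rho^m, the lower bound d^(m+1) for the length of the image of a
    cylinder turns the rate into Hölder continuity for any exponent alpha with
    rho <= d^alpha (holder_gap, holder_p). The members of a consecutive pair
    between x and y are used as intermediate points, because an interval of
    pasts without long common prefix can have a very short image.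

    Finally h conjugates T to the shift off the countable set of eventually
    constant pasts (extension_h, itinerary_h). Invariance, ergodicity and the
    conditional probabilities are transported from mu along h. *)

(** * The lexicographic order on pasts *)

Section LexicographicOrder.
Context {n : nat}.
Implicit Types (x y z u : past n) (b : 'I_n.+1) (s : seq 'I_n.+1).

Lemma push_eta x : push (x 0%N) (drop_last x) = x.
Proof. by apply: funext; case. Qed.

Lemma lexlt_irr x : ~ lexlt x x.
Proof. by case=> m [_]; rewrite ltnn. Qed.

Lemma lexlt_trans x y z : lexlt x y -> lexlt y z -> lexlt x z.
Proof.
move=> [k [kE kl]] [l [lE ll]]; case: (ltngtP k l) => kl'.
- exists k; split; last by rewrite -lE.
  by move=> i ik; rewrite kE// lE// (ltn_trans ik).
- exists l; split; last by rewrite kE.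
  by move=> i il; rewrite kE ?lE// (ltn_trans il).
- exists k; split; last by apply: (ltn_trans kl); rewrite kl'.
  by move=> i ik; rewrite kE// lE// -kl'.
Qed.

Lemma lexlt_total x y : [\/ x = y, lexlt x y | lexlt y x].
Proof.
have [xy|/existsNP ex] := pselect (forall i, x i = y i).
  by apply: Or31; exact: funext.
have {}ex : exists i, x i != y i by case: ex => i /eqP; exists i.
case: (ex_minnP ex) => m xym minm.
have E i : (i < m)%N -> x i = y i.
  move=> im; apply/eqP; apply/negPn/negP => /minm; by rewrite leqNgt im.
case: (ltngtP (x m) (y m)) => H; [apply: Or32|apply: Or33|].
- by exists m.
- by exists m; split => // i /E.
- by move: xym; rewrite (val_inj H) eqxx.
Qed.

Lemma lexle_lt_trans x y z : lexle x y -> lexlt y z -> lexlt x z.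
Proof. by move=> [->//|]; exact: lexlt_trans. Qed.

Lemma lexlt_le_trans x y z : lexlt x y -> lexle y z -> lexlt x z.
Proof. by move=> + [<-//|]; exact: lexlt_trans. Qed.

Lemma lexle_trans x y z : lexle x y -> lexle y z -> lexle x z.
Proof. by move=> [->//|xy] yz; right; exact: lexlt_le_trans yz. Qed.

Lemma lexleNgt x y : lexle x y <-> ~ lexlt y x.
Proof.
split=> [xy yx|nyx]; first exact: (lexlt_irr (lexle_lt_trans xy yx)).
by case: (lexlt_total x y); [left|right|].
Qed.

Lemma lexltNge x y : lexlt x y <-> ~ lexle y x.
Proof. by rewrite lexleNgt; split=> [?|/contrapT]. Qed.

Lemma lexle_total x y : lexle x y \/ lexle y x.
Proof. by case: (lexlt_total x y) => [->|?|?]; [left; left|left; right|right; right]. Qed.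

Lemma lexle_anti x y : lexle x y -> lexle y x -> x = y.
Proof. by move=> [//|xy] /lexleNgt. Qed.

Lemma lexlt_push b x y : lexlt (push b x) (push b y) <-> lexlt x y.
Proof.
split=> -[m [mE ml]].
  case: m => [|m] in mE ml *; first by rewrite ltnn in ml.
  by exists m; split=> // i im; exact: (mE i.+1).
by exists m.+1; split=> // -[//|i] im; exact: mE.
Qed.

Lemma lexle_push b x y : lexle (push b x) (push b y) <-> lexle x y.
Proof. by rewrite !lexleNgt lexlt_push. Qed.

Lemma lexlt_head x y : (x 0%N < y 0%N)%N -> lexlt x y.
Proof. by exists 0%N. Qed.

Lemma lexle_head x y : lexle x y -> (x 0%N <= y 0%N)%N.
Proof. by move=> /lexleNgt nyx; rewrite leqNgt; apply/negP => /lexlt_head. Qed.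

Lemma lexle_allmin x : lexle (@allmin n) x.
Proof. by apply/lexleNgt => -[m [_]]. Qed.

Lemma lexle_allmax x : lexle x (@allmax n).
Proof. by apply/lexleNgt => -[m [_]]; rewrite /allmax /= ltnNge leq_ord. Qed.

(** ** Cylinders *)

Definition agree (m : nat) x y := forall i, (i < m)%N -> x i = y i.

Definition cylmin m x : past n := fun i => if (i < m)%N then x i else ord0.
Definition cylmax m x : past n := fun i => if (i < m)%N then x i else ord_max.

Lemma agree_sym m x y : agree m x y -> agree m y x.
Proof. by move=> xy i /xy. Qed.
Global Arguments agree_sym {m x y} _ i _.

Lemma agree_trans m x y z : agree m x y -> agree m y z -> agree m x z.
Proof. by move=> xy yz i im; rewrite xy// yz. Qed.
Global Arguments agree_trans {m x y z} _ _ i _.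

Lemma agreeW k m x y : (k <= m)%N -> agree m x y -> agree k x y.
Proof. by move=> km xy i ik; apply: xy; exact: leq_trans km. Qed.
Global Arguments agreeW {k m x y} _ _ i _.

Lemma agree_cylmin m x : agree m x (cylmin m x).
Proof. by move=> i im; rewrite /cylmin im. Qed.
Global Arguments agree_cylmin m x i _ : clear implicits.

Lemma agree_cylmax m x : agree m x (cylmax m x).
Proof. by move=> i im; rewrite /cylmax im. Qed.
Global Arguments agree_cylmax m x i _ : clear implicits.

Lemma cylmin_le m x y : agree m x y -> lexle (cylmin m x) y.
Proof.
move=> xy; apply/lexleNgt => -[k [_]]; rewrite /cylmin.
by case: ifP => [/xy -> |]; rewrite ?ltnn.
Qed.

Lemma le_cylmax m x y : agree m x y -> lexle y (cylmax m x).
Proof.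
move=> xy; apply/lexleNgt => -[k [_]]; rewrite /cylmax.
by case: ifP => [/xy -> |_] /=; rewrite ?ltnn// ltnNge leq_ord.
Qed.

(** Cylinders are convex: the first places where z leaves x upwards and y     *)
(** downwards cannot both lie in the common prefix of x and y.                *)
Lemma agree_between m x y z :
  agree m x y -> lexle x z -> lexle z y -> agree m x z.
Proof.
move=> xy [<-//|[k [kE kl]]] [->//|[l [lE ll]]] i im.
case: (ltnP i k) => [/kE//|ki]; case: (ltnP i l) => [/lE ->|li].
  exact: xy.
exfalso; case: (ltngtP k l) => kl'.
- move: kl; rewrite lE// -xy ?ltnn//; exact: leq_ltn_trans ki im.
- move: ll; rewrite -kE// -xy ?ltnn//; exact: leq_ltn_trans li im.
- move: ll; rewrite -kl' -xy; last exact: leq_ltn_trans ki im.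
  by move=> /(ltn_trans kl); rewrite ltnn.
Qed.
Global Arguments agree_between {m x y z} _ _ _ i _.

Lemma pushsE s x i :
  pushs s x i = if (i < size s)%N then nth ord0 s i else x (i - size s)%N.
Proof.
elim: s i => [|c s IH] i /=; first by rewrite subn0.
by case: i => //= i; rewrite IH ltnS subSS.
Qed.

(** ** Consecutive pasts *)

(** Immediate neighbours for the order (below_lt). Every other pair x < y has *)
(** a whole cylinder between its members (lexlt_gap).                         *)
Definition consecutive x y := exists a s, x = below a s /\ y = above a s.

Lemma lexlt_below_above (a : 'I_n) s : lexlt (below a s) (above a s).
Proof.
rewrite /below /above; elim: s => [|c s IH] /=.
  by apply: lexlt_head => /=; rewrite /bump.
exact/lexlt_push.
Qed.

Lemma lexlt_allmaxF x : ~ lexlt (@allmax n) x.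
Proof. by move/lexltNge; apply; exact: lexle_allmax. Qed.

(** Common last symbols are dropped until the word s is empty; the tail of    *)
(** below a [::] being maximal, u can then only have a larger first symbol.   *)
Lemma below_lt (a : 'I_n) s u : lexlt (below a s) u -> lexle (above a s) u.
Proof.
rewrite /below /above; elim: s u => [|c s IH] u; rewrite -(push_eta u) /=.
  move=> au; have := lexle_head (or_intror au).
  rewrite leq_eqVlt => /orP[/eqP E|au0].
    have {}E : sym a = u 0%N by exact: val_inj.
    by move: au; rewrite E lexlt_push => /lexlt_allmaxF.
  have [ua|ua] := eqVneq (symS a) (u 0%N).
    by rewrite ua; apply/lexle_push; exact: lexle_allmin.
  right; apply: lexlt_head => /=; rewrite /bump/= add1n ltn_neqAle au0 andbT.
  by apply: contra ua => /eqP E; apply/eqP/val_inj.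
move=> cu; have := lexle_head (or_intror cu).
rewrite leq_eqVlt => /orP[/eqP E|cu0]; last by right; exact: lexlt_head.
have {}E : c = u 0%N by exact: val_inj.
by move: cu; rewrite E lexlt_push => /IH/lexle_push.
Qed.

(** If x < y differ first at k, a symbol of x after k that is not maximal, or *)
(** one of y that is not minimal, or a symbol strictly between x k and y k    *)
(** gives a cylinder between x and y; otherwise x and y are consecutive.      *)
Lemma lexlt_gap x y : lexlt x y -> consecutive x y \/
  exists m z, forall u, agree m z u -> lexlt x u /\ lexlt u y.
Proof.
move=> [k [kE kl]].
have [[i [ki xi]]|xmax] := pselect (exists i, (k < i)%N /\ (x i < n)%N).
  right; exists i.+1, (fun j => if j == i then ord_max else x j) => u zu.
  split.
    exists i; split.
      by move=> j ji; rewrite -zu ?ltn_eqF// ltnS ltnW.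
    by rewrite -zu// eqxx.
  exists k; split=> [j jk|].
    rewrite -zu; first by rewrite ltn_eqF ?kE// (ltn_trans jk).
    by rewrite ltnS ltnW// (ltn_trans jk).
  by rewrite -zu ?(ltn_eqF ki)// ltnS ltnW.
have [[i [ki yi]]|ymin] := pselect (exists i, (k < i)%N /\ (0 < y i)%N).
  right; exists i.+1, (fun j => if j == i then ord0 else y j) => u zu.
  split; last first.
    exists i; split.
      by move=> j ji; rewrite -zu ?ltn_eqF// ltnS ltnW.
    by rewrite -zu// eqxx.
  exists k; split=> [j jk|].
    rewrite -zu; first by rewrite ltn_eqF ?kE// (ltn_trans jk).
    by rewrite ltnS ltnW// (ltn_trans jk).
  by rewrite -zu ?(ltn_eqF ki)// ltnS ltnW.
have [xy|xy] := ltnP (x k).+1 (y k).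
  have xn : ((x k).+1 < n.+1)%N by apply: (ltn_trans xy).
  right; exists k.+1, (fun j => if j == k then Ordinal xn else x j) => u zu.
  split; exists k; split.
  - by move=> j jk; rewrite -zu ?ltn_eqF// ltnS ltnW.
  - by rewrite -zu// eqxx /=.
  - by move=> j jk; rewrite -zu ?ltn_eqF ?kE// ltnS ltnW.
  - by rewrite -zu// eqxx /=.
left.
have xn : (x k < n)%N by apply: (leq_trans kl); rewrite -ltnS.
exists (Ordinal xn), (mkseq x k).
have tailE (c : 'I_n.+1) w i : (k < i)%N ->
    pushs (rcons (mkseq x k) c) w i = w (i - k.+1)%N.
  by move=> ki; rewrite pushsE size_rcons size_mkseq ltnNge ki.
have headE (c : 'I_n.+1) w i : (i < k)%N ->
    pushs (rcons (mkseq x k) c) w i = x i.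
  move=> ik; rewrite pushsE size_rcons size_mkseq ltnS (ltnW ik).
  by rewrite nth_rcons size_mkseq ik nth_mkseq.
have midE (c : 'I_n.+1) w : pushs (rcons (mkseq x k) c) w k = c.
  by rewrite pushsE size_rcons size_mkseq ltnS leqnn nth_rcons size_mkseq ltnn eqxx.
rewrite /below /above; split; apply/funext => i; case: (ltngtP i k) => ik.
- by rewrite headE.
- rewrite tailE//; apply: val_inj => /=; apply/eqP; rewrite eqn_leq leq_ord/=.
  by rewrite leqNgt; apply/negP => xi; apply: xmax; exists i.
- by rewrite ik midE; apply: val_inj.
- by rewrite headE// kE.
- rewrite tailE//; apply: val_inj => /=; apply/eqP; rewrite -leqn0.
  by rewrite leqNgt; apply/negP => yi; apply: ymin; exists i.
- rewrite ik midE; apply: val_inj => /=; rewrite /bump/= add1n.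
  by apply/eqP; rewrite eqn_leq xy kl.
Qed.

(** ** Eventually constant pasts *)

Definition ev_min x := exists m, forall i, (m <= i)%N -> x i = ord0.
Definition ev_max x := exists m, forall i, (m <= i)%N -> x i = ord_max.
Definition ev_extreme : set (past n) := [set x | ev_min x \/ ev_max x].

Lemma ev_max_below (a : 'I_n) s : ev_max (below a s).
Proof.
exists (size (rcons s (sym a))) => i si.
by rewrite /below pushsE ltnNge si.
Qed.

Lemma ev_min_above (a : 'I_n) s : ev_min (above a s).
Proof.
exists (size (rcons s (symS a))) => i si.
by rewrite /above pushsE ltnNge si.
Qed.

Lemma countable_exceptional : countable (@exceptional n).
Proof.
pose f (q : bool * 'I_n * seq 'I_n.+1) :=
  if q.1.1 then below q.1.2 q.2 else above q.1.2 q.2.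
apply: (@sub_countable _ _ _ (f @` setT)).
  apply: subset_card_le => x [a [s [->|->]]].
    by exists (true, a, s).
  by exists (false, a, s).
exact: sub_countable (card_image_le _ _) (countableP _).
Qed.

Lemma countable_ev_extreme : countable ev_extreme.
Proof.
pose f (q : bool * seq 'I_n.+1) :=
  pushs q.2 (if q.1 then @allmin n else @allmax n).
apply: (@sub_countable _ _ _ (f @` setT)).
  apply: subset_card_le => x [[m xm]|[m xm]].
    exists (true, mkseq x m) => //; apply/funext => i; rewrite /f pushsE size_mkseq.
    by case: ltnP => im; rewrite ?nth_mkseq// xm.
  exists (false, mkseq x m) => //; apply/funext => i; rewrite /f pushsE size_mkseq.
  by case: ltnP => im; rewrite ?nth_mkseq// xm.
exact: sub_countable (card_image_le _ _) (countableP _).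
Qed.

Lemma cylmin_lt m x : ~ ev_min x -> lexlt (cylmin m x) x.
Proof.
move=> nx; have [xE|//] := cylmin_le (fun i (_ : (i < m)%N) => erefl (x i)).
by case: nx; exists m => i mi; rewrite -xE /cylmin ltnNge mi.
Qed.

Lemma lt_cylmax m x : ~ ev_max x -> lexlt x (cylmax m x).
Proof.
move=> nx; have [xE|//] := le_cylmax (fun i (_ : (i < m)%N) => erefl (x i)).
by case: nx; exists m => i mi; rewrite xE /cylmax ltnNge mi.
Qed.

End LexicographicOrder.
(** * The law of the past *)

Section WordMeasurability.
Context {n : nat}.

Lemma measurable_coord (I : Type) (i : I) (a : 'I_n.+1) :
  measurable ([set x | x i = a] : set (words I n)).
Proof. by apply: sub_sigma_algebra; exists i, a. Qed.

Lemma measurable_words d (T : measurableType d) (I : Type)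
    (f : T -> words I n) :
  (forall i (a : 'I_n.+1), measurable [set t | f t i = a]) ->
  measurable_fun setT f.
Proof.
move=> mf; apply: (@measurability _ _ T (words I n) setT f (@coord_sets I n)) => //.
by move=> _ /= [_ [i [a ->]] <-]; rewrite setTI; exact: mf.
Qed.

Lemma measurable_drop_last : measurable_fun setT (@drop_last n).
Proof. by apply: measurable_words => i a; exact: (measurable_coord i.+1). Qed.

Lemma measurable_past0 : measurable_fun setT (@past0 n).
Proof. by apply: measurable_words => i a; exact: measurable_coord. Qed.

Lemma measurable_word_shift : measurable_fun setT (@word_shift n).
Proof. by apply: measurable_words => i a; exact: measurable_coord. Qed.

Lemma measurable_agree m (x : past n) : measurable [set y : past n | agree m x y].
Proof.
rewrite (_ : mkset _ = \bigcap_(i in `I_m) [set y : past n | y i = x i]).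
  by apply: bigcap_measurableType => i _; exact: measurable_coord.
by apply/seteqP; split=> [y xy i /= im|y xy i im]; rewrite xy.
Qed.

Lemma measurable_past1pt (x : past n) : measurable [set x].
Proof.
rewrite (_ : [set x] = \bigcap_i [set y : past n | y i = x i]).
  by apply: bigcap_measurableType => i _; exact: measurable_coord.
by apply/seteqP; split=> [y -> //|y xy]; apply/funext => i; exact: xy.
Qed.

Lemma measurable_lexlt (x : past n) : measurable [set y : past n | lexlt y x].
Proof.
rewrite (_ : mkset _ = \bigcup_m ([set y : past n | agree m x y] `&`
   \bigcup_(a in [set a : 'I_n.+1 | (a < x m)%N]) [set y : past n | y m = a])).
  apply: bigcupT_measurable => m; apply: measurableI.
    exact: measurable_agree.
  apply: fin_bigcup_measurable; first exact: finite_finset.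
  by move=> a _; exact: measurable_coord.
apply/seteqP; split=> [y [m [mE ml]]|y [m _ [/= xy [a /= ax ya]]]].
  by exists m => //; split; [move=> i /mE|exists (y m)].
by exists m; split=> [i /xy //|]; rewrite ya.
Qed.

Lemma measurable_lexle (x : past n) : measurable [set y : past n | lexle y x].
Proof.
rewrite (_ : mkset _ = [set x] `|` [set y | lexlt y x]).
  by apply: measurableU; [exact: measurable_past1pt|exact: measurable_lexlt].
by apply/seteqP; split=> y.
Qed.

(** Finite sets of constraints on the symbols: unlike the coordinate sets,    *)
(** these sets are stable under intersection.                                 *)
Definition satisfies (l : seq (nat * 'I_n.+1)) (x : nat -> 'I_n.+1) : bool :=
  all (fun q => x q.1 == q.2) l.
Definition constraint l : set (past n) := [set x | satisfies l x].

Lemma measurable_constraint l : measurable (constraint l).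
Proof.
elim: l => [|[i a] l IH].
  by rewrite (_ : constraint _ = setT)//; apply/seteqP; split.
rewrite (_ : constraint _ = [set x : past n | x i = a] `&` constraint l).
  by apply: measurableI => //; exact: measurable_coord.
by apply/seteqP; split=> x /=; [move=> /andP[/eqP ?]|move=> [/eqP ? ?]; apply/andP].
Qed.

Lemma constraint_generated : measurable = <<s range constraint >> :> set (set (past n)).
Proof.
apply/seteqP; split; apply: smallest_sub; try exact: smallest_sigma_algebra.
  move=> _ [i [a ->]]; apply: sub_sigma_algebra; exists [:: (i, a)] => //.
  by apply/seteqP; split=> x; rewrite /constraint /satisfies /= andbT => /eqP.
by move=> _ [l _ <-]; exact: measurable_constraint.
Qed.

Lemma constraint_setI : setI_closed (range constraint).
Proof.
move=> _ _ [l _ <-] [k _ <-]; exists (l ++ k) => //; apply/seteqP; split=> x /=.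
  by rewrite /constraint /satisfies /= all_cat => /andP[].
by move=> [xl xk]; rewrite /constraint /satisfies /= all_cat; apply/andP.
Qed.

Local Notation pasts_topology :=
  (prod_topology (fun _ : nat => discrete_topology 'I_n.+1)).

Lemma continuous_constraint (R : realType) l :
  continuous ((fun x => (satisfies l x)%:R) : pasts_topology -> R).
Proof.
move=> x; have Fx : Filter (nbhs x) by exact: nbhs_filter.
have near_eq :
    nbhs x [set y : pasts_topology | satisfies l y = satisfies l x].
  elim: l => [|[i a] l IH]; first exact: filterE.
  have nx : nbhs x [set y : pasts_topology | y i = x i].
    have := @proj_continuous nat (fun=> discrete_topology 'I_n.+1) i x.
    by move=> /(_ [set x i]); apply; exact: discrete_set1.
  apply: filterS (filterI nx IH) => y [yi yl].
  by congr andb; [rewrite /= yi|exact: yl].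
by move=> A /nbhs_singleton Ax; apply: filterS near_eq => y /= ->.
Qed.

End WordMeasurability.

HB.instance Definition _ n :=
  isMeasurableFun.Build _ _ _ _ (@past0 n) measurable_past0.
HB.instance Definition _ n :=
  isMeasurableFun.Build _ _ _ _ (@drop_last n) measurable_drop_last.

Lemma past0_shift n (z : words int n) : past0 (word_shift z) = drop_last (past0 z).
Proof.
by apply/funext => i; rewrite /drop_last /past0 /word_shift intS opprD addrC.
Qed.

Section PastLaw.
Context {R : realType} {n : nat}.
Implicit Types (P : probability (words int n) R).

Definition past_law P : probability (past n) R := distribution P (@past0 n).

Lemma past_lawE P A : past_law P A = P (@past0 n @^-1` A).
Proof. by []. Qed.

Lemma past_law_drop_last P A : stationary P -> measurable A ->
  past_law P (@drop_last n @^-1` A) = past_law P A.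
Proof.
move=> sP mA; rewrite !past_lawE -(sP (@past0 n @^-1` A)); last first.
  by rewrite -[X in measurable X]setTI; exact: measurable_past0.
by congr (P (_ @^-1` A)); apply/funext => z; rewrite /= past0_shift.
Qed.

Section OneStep.
Variables (P : probability (words int n) R) (p : 'I_n.+1 -> past n -> R).
Hypotheses (ptrans : transition_family p) (sP : stationary P)
  (Pp : invariant_wrt P p).
Let mu := past_law P.
Let p0 a x : 0 <= p a x. Proof. by case: ptrans => /(_ a x)/andP[]. Qed.
Let mp a : measurable_fun setT (p a). Proof. by case: ptrans. Qed.

Let mpD a B : measurable_fun B (EFin \o p a).
Proof. by apply/measurable_EFinP; exact: measurable_funS (mp a). Qed.

Definition density (a : 'I_n.+1) (B : set (past n)) : \bar R :=
  (\int[mu]_(x in B) (p a x)%:E)%E.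

Let density0 a : density a set0 = 0%E.
Proof. exact: integral_set0. Qed.

Let density_ge0 a B : (0 <= density a B)%E.
Proof. by apply: integral_ge0 => x _; rewrite lee_fin. Qed.

Let density_sigma_additive a : semi_sigma_additive (density a).
Proof.
move=> F mF tF mUF; rewrite /density ge0_integral_bigcup//.
- by apply: is_cvg_nneseries => k _ _; exact: density_ge0.
- exact: mpD.
- by move=> x _; rewrite lee_fin.
Qed.

HB.instance Definition _ a := isMeasure.Build _ _ _ (density a)
  (density0 a) (density_ge0 a) (@density_sigma_additive a).

(** The invariance hypothesis for the indicator of a constraint whose first   *)
(** condition is that the last symbol be a: of the sum over the symbols, only *)
(** the term of a survives.                                                   *)
Let constraint_mass a l : mu (constraint ((0%N, a) ::
  [seq (q.1.+1, q.2) | q <- l])) = density a (constraint l).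
Proof.
have mc k : measurable (constraint k : set (past n)) by exact: measurable_constraint.
pose f (x : past n) : R := (satisfies ((0%N, a) :: [seq (q.1.+1, q.2) | q <- l]) x)%:R.
have fE x b : f (push b x) = (b == a)%:R * \1_(constraint l) x.
  rewrite /f indicE /= -natrM mulnb; congr (_ && _)%:R.
  rewrite mem_setE /constraint /satisfies all_map.
  by rewrite /preim /=.
have := Pp (@continuous_constraint n R ((0%N, a) :: [seq (q.1.+1, q.2) | q <- l])).
pose g x := p a x * \1_(constraint l) x.
have g0 x : 0 <= g x by rewrite /g mulr_ge0// indicE.
have g0' x : (0 <= (EFin \o g) x)%E by rewrite lee_fin.
have mg : measurable_fun setT (EFin \o g).
  by apply/measurable_EFinP; apply: measurable_funM => //; exact: measurable_indic.
have mf : measurable_fun setT (EFin \o f).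
  rewrite (_ : f = \1_(constraint ((0%N, a) :: [seq (q.1.+1, q.2) | q <- l]))).
    by apply/measurable_EFinP; exact: measurable_indic.
  by apply/funext => x; rewrite indicE mem_setE.
rewrite (_ : (\int[P]_z _)%E = (\int[P]_z ((EFin \o f) \o @past0 n) z)%E)//.
rewrite -ge0_integral_distribution//; last by move=> x /=; rewrite lee_fin.
rewrite (_ : (\int[P]_z _)%E =
  (\int[P]_z (((EFin \o g) \o @drop_last n) \o @past0 n) z)%E); last first.
  apply: eq_integral => z _ /=; congr EFin.
  rewrite (bigD1 a)//= big1 ?addr0 => [|b ba].
    by rewrite [X in _ * X](fE (past1 z) a) eqxx mul1r.
  by rewrite [X in _ * X](fE (past1 z) b) (negbTE ba) mul0r mulr0.
rewrite -ge0_integral_distribution//; last 2 first.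
  by apply: measurableT_comp => //; exact: measurable_drop_last.
  by move=> x /=; rewrite lee_fin.
rewrite -(ge0_integral_distribution (@drop_last n : {mfun _ >-> _}) mg g0').
rewrite (_ : (\int[distribution mu (@drop_last n)]_y (EFin \o g) y)%E =
             (\int[mu]_y (EFin \o g) y)%E); last first.
  by apply: eq_measure_integral => A mA _; exact: past_law_drop_last.
rewrite (_ : EFin \o f = EFin \o \1_(constraint ((0%N, a) ::
    [seq (q.1.+1, q.2) | q <- l]))); last first.
  by apply/funext => x; rewrite /= indicE mem_setE.
rewrite integral_indic// setIT => ->.
rewrite /density [RHS]integral_mkcond; apply: eq_integral => x _.
rewrite /g /patch /= indicE; case: ifP => _; by rewrite ?mulr1 ?mulr0.
Qed.

(** Both sides are measures in B, and they agree on constraints, where the    *)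
(** invariance hypothesis applies because such sets are clopen.               *)
Lemma past_law_push a B : measurable B ->
  (past_law P [set x | x 0%N = a /\ B (drop_last x)] =
   \int[past_law P]_(x in B) (p a x)%:E)%E.
Proof.
move=> mB; have ma := @measurable_coord n nat 0%N a.
rewrite (_ : mkset _ = @drop_last n @^-1` B `&` [set x | x 0%N = a]); last first.
  by apply/seteqP; split=> x /= [].
rewrite -[LHS]/(pushforward (mrestr mu ma) (@drop_last n) B).
rewrite -[RHS]/(density a B).
apply: (measure_unique (range (@constraint n)) (fun=> setT)) => //.
- exact: constraint_generated.
- exact: constraint_setI.
- by move=> _; exists [::] => //; apply/seteqP; split.
- by rewrite bigcup_const//; exists 0%N.
- move=> _ [l _ <-]; apply: etrans (constraint_mass a l); congr (mu _).
  apply/seteqP; split=> x; rewrite /constraint /satisfies /= all_map.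
    by move=> [xl /eqP xa]; apply/andP.
  by move=> /andP[/eqP xa xl].
- move=> _; apply: le_lt_trans (ltry 1).
  rewrite /= /pushforward /mrestr preimage_setT setTI; exact: probability_le1.
Qed.

End OneStep.

End PastLaw.

(** * The distribution function of the past *)

Section DistributionFunction.
Context {R : realType} {n : nat}.
Variables (mu : probability (past n) R).

Definition mass (A : set (past n)) : R := fine (mu A).
Definition cdf (x : past n) : R := mass [set y | lexle y x].
Definition lexoc (x y : past n) : set (past n) := [set u | lexlt x u /\ lexle u y].

Lemma measurable_lexoc x y : measurable (lexoc x y).
Proof.
rewrite (_ : lexoc x y = ~` [set u | lexle u x] `&` [set u | lexle u y]).
  apply: measurableI; last exact: measurable_lexle.
  by apply: measurableC; exact: measurable_lexle.
by apply/seteqP; split=> u [/lexltNge].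
Qed.

Lemma mass_ge0 A : 0 <= mass A.
Proof. by rewrite fine_ge0. Qed.

Lemma massE A : measurable A -> mu A = (mass A)%:E.
Proof. by move=> mA; rewrite /mass fineK// fin_num_measure. Qed.

Lemma massU A B : measurable A -> measurable B -> A `&` B = set0 ->
  mass (A `|` B) = mass A + mass B.
Proof. by move=> mA mB AB; rewrite /mass measureU// fineD// fin_num_measure. Qed.

Lemma mass_le A B : measurable A -> measurable B -> A `<=` B -> mass A <= mass B.
Proof.
by move=> mA mB AB; rewrite fine_le ?fin_num_measure// le_measure// inE.
Qed.

Lemma mass_le1 A : measurable A -> mass A <= 1.
Proof. by move=> mA; rewrite -lee_fin -massE// probability_le1. Qed.

Lemma mass_lexoc x y : lexle x y -> mass (lexoc x y) = cdf y - cdf x.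
Proof.
move=> xy; rewrite /cdf.
rewrite (_ : [set u | lexle u y] = [set u | lexle u x] `|` lexoc x y).
  rewrite massU; first by rewrite addrC addKr.
  - exact: measurable_lexle.
  - exact: measurable_lexoc.
  - by apply/seteqP; split=> // u [/lexleNgt ux []].
apply/seteqP; split=> u => [uy|[ux|[]//]]; last exact: lexle_trans xy.
by have [|/lexltNge] := pselect (lexle u x); [left|right].
Qed.

Lemma cdf_le x y : lexle x y -> cdf x <= cdf y.
Proof. by move=> xy; rewrite -subr_ge0 -mass_lexoc// mass_ge0. Qed.

Lemma cdf_lt x y : cdf x < cdf y -> lexlt x y.
Proof. by move=> xy; apply/lexltNge => /cdf_le; rewrite leNgt xy. Qed.

Lemma cdf_itv x : 0 <= cdf x <= 1.
Proof. by rewrite mass_ge0 mass_le1//; exact: measurable_lexle. Qed.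

Lemma cdf_allmax : cdf (@allmax n) = 1.
Proof.
rewrite /cdf (_ : mkset _ = setT) /mass ?probability_setT//.
by apply/seteqP; split=> // y _; exact: lexle_allmax.
Qed.

Variables (p : 'I_n.+1 -> past n -> R) (d : R).

(** The only properties of the process that its interval map depends on, for  *)
(** the distribution function of mu.                                          *)
Definition disintegrated : Prop :=
  [/\ (0 < n)%N, 0 < d, (forall a x, d <= p a x), (forall x, \sum_a p a x = 1)
    & forall a B, measurable B ->
      (measurable_fun setT (p a)) /\
      (mu [set x | x 0%N = a /\ B (drop_last x)] = \int[mu]_(x in B) (p a x)%:E)%E].

Hypothesis dis : disintegrated.

Let n_gt0 : (0 < n)%N. Proof. by case: dis. Qed.
Let d_gt0 : 0 < d. Proof. by case: dis. Qed.
Let dp a x : d <= p a x. Proof. by case: dis. Qed.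
Let sum_p x : \sum_a p a x = 1. Proof. by case: dis. Qed.
Let mp a : measurable_fun setT (p a).
Proof. by case: dis => _ _ _ _ /(_ a setT measurableT)[]. Qed.
Let p_ge0 a x : 0 <= p a x. Proof. exact: le_trans (ltW d_gt0) (dp a x). Qed.

Definition push_set (a : 'I_n.+1) (B : set (past n)) : set (past n) :=
  [set x | x 0%N = a /\ B (drop_last x)].

Lemma measurable_push_set a B : measurable B -> measurable (push_set a B).
Proof.
move=> mB; rewrite (_ : push_set a B = [set x | x 0%N = a] `&` @drop_last n @^-1` B).
  apply: measurableI; first exact: measurable_coord.
  by rewrite -[X in measurable X]setTI; exact: measurable_drop_last.
by apply/seteqP; split.
Qed.

(** At least one other symbol has probability d or more.                      *)
Lemma p_le a x : p a x <= 1 - d.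
Proof.
have [b ba] : exists b : 'I_n.+1, b != a.
  have [->|?] := eqVneq a ord0; last by exists ord0; rewrite eq_sym.
  by exists ord_max; rewrite -val_eqE /= -lt0n.
have := sum_p x; rewrite (bigD1 a)//= (bigD1 b)//=; set r := \sum_(_ | _) _.
have r0 : 0 <= r by exact: sumr_ge0.
by have := dp b x; lra.
Qed.

Lemma d_lt1 : 0 < 1 - d.
Proof. exact: lt_le_trans d_gt0 (le_trans (dp ord0 (@allmin n)) (p_le _ _)). Qed.

(** A bound of p(a | .) on B bounds its integral over B, which is the mass of *)
(** the pasts with last symbol a and remainder in B.                          *)
Lemma mass_push_set a B c C : measurable B ->
  (forall u, B u -> c <= p a u <= C) ->
  c * mass B <= mass (push_set a B) <= C * mass B.
Proof.
move=> mB cC.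
have mpB : measurable_fun B (EFin \o p a).
  by apply/measurable_EFinP; exact: measurable_funS (mp a).
have ge0_max (e : R) : e * mass B <= Num.max 0 e * mass B.
  by rewrite ler_wpM2r ?mass_ge0// le_max lexx orbT.
have dE : mu (push_set a B) = (\int[mu]_(x in B) (p a x)%:E)%E.
  by case: dis => _ _ _ _ /(_ a B mB)[].
apply/andP; split.
  apply: (le_trans (ge0_max c)).
  rewrite -lee_fin EFinM -!massE//; last exact: measurable_push_set.
  rewrite dE -integral_cst//; apply: ge0_le_integral => //.
  - by move=> x _ /=; rewrite lee_fin le_max lexx.
  - by move=> x Bx /=; rewrite lee_fin ge_max p_ge0; case/andP: (cC x Bx).
have [->|/set0P[x Bx]] := eqVneq B set0.
  rewrite (_ : push_set a set0 = set0); first by rewrite /mass measure0 mulr0.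
  by apply/seteqP; split=> // x [].
have C0 : 0 <= C.
  by case/andP: (cC x Bx) => _; apply: le_trans.
rewrite -lee_fin EFinM -!massE//; last exact: measurable_push_set.
rewrite dE -integral_cst//; apply: ge0_le_integral => //.
- by move=> y _; rewrite lee_fin.
- by move=> y Bx' /=; rewrite lee_fin; case/andP: (cC y Bx').
Qed.

Lemma push_set_lexoc a x y : push_set a (lexoc x y) = lexoc (push a x) (push a y).
Proof.
apply/seteqP; split=> u.
  by move=> [ua [xu uy]]; rewrite -(push_eta u) ua; split;
    [exact/lexlt_push|exact/lexle_push].
move=> [xu uy].
have ua : u 0%N = a.
  apply: val_inj; apply/eqP; rewrite eqn_leq (lexle_head uy).
  exact: (lexle_head (or_intror xu)).
have uE := push_eta u; rewrite ua in uE.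
by split=> //; move: xu uy; rewrite -uE => /lexlt_push ? /lexle_push.
Qed.

Lemma lexle_push1 (a : 'I_n.+1) x y : lexle x y -> lexle (push a x) (push a y).
Proof. by move=> ?; exact/lexle_push. Qed.

(** The one-step estimate behind all statements about slopes: prepending a    *)
(** multiplies increments of the distribution function by a mean value of p.  *)
Lemma cdf_push_between a x y c C : lexle x y ->
  (forall u, lexlt x u -> lexle u y -> c <= p a u <= C) ->
  c * (cdf y - cdf x) <= cdf (push a y) - cdf (push a x) <= C * (cdf y - cdf x).
Proof.
move=> xy cC; rewrite -!mass_lexoc//; last exact: lexle_push1.
rewrite -push_set_lexoc; apply: mass_push_set; first exact: measurable_lexoc.
by move=> u []; exact: cC.
Qed.

Lemma cdf_push_lip a x y : lexle x y ->
  d * (cdf y - cdf x) <= cdf (push a y) - cdf (push a x) <= cdf y - cdf x.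
Proof.
move=> xy; have := @cdf_push_between a x y d (1 - d) xy.
move=> /(_ (fun u _ _ => introT andP (conj (dp a u) (p_le a u))))/andP[-> /le_trans->//].
by rewrite ler_piMl ?subr_ge0 ?cdf_le// gerBl ltW.
Qed.

(** Each symbol multiplies the mass by a mean value of p, between d and 1 - d.*)
Lemma mass_cyl m x : d ^+ m <= mass [set y | agree m x y] <= (1 - d) ^+ m.
Proof.
elim: m x => [|m IH] x.
  rewrite !expr0 (_ : mkset _ = setT); last by apply/seteqP; split.
  by rewrite /mass probability_setT lexx.
rewrite (_ : mkset _ = push_set (x 0%N) [set y | agree m (drop_last x) y]).
  have mA := measurable_agree m (drop_last x).
  have /andP[lo up] := IH (drop_last x).
  have := @mass_push_set (x 0%N) _ d (1 - d) mA.
  move=> /(_ (fun u _ => introT andP (conj (dp _ u) (p_le _ u))))/andP[lo' up'].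
  rewrite !exprS (le_trans _ lo') ?(le_trans up')//.
    by rewrite ler_wpM2l// ltW// d_lt1.
  by rewrite ler_wpM2l// ltW.
apply/seteqP; split=> y; first by move=> xy; split=> [|i im]; rewrite ?xy//; exact: xy.
by move=> [yx xy] [|i] im; [rewrite yx|exact: xy].
Qed.

Lemma mass_cyl_small (e : R) : 0 < e ->
  exists m, forall x, mass [set y | agree m x y] < e.
Proof.
move=> e0; have d1 : `|1 - d| < 1.
  by rewrite ger0_norm ?(ltW d_lt1)// gtrBl.
have /cvgrPdist_lt /(_ e e0)[m _ /(_ m (leqnn m))] := cvg_expr d1.
rewrite sub0r normrN => me; exists m => x.
apply: le_lt_trans me; rewrite ger0_norm ?exprn_ge0 ?(ltW d_lt1)//.
by case/andP: (mass_cyl m x).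
Qed.

Lemma mass1 x : mass [set x] = 0.
Proof.
apply/eqP; rewrite eq_le mass_ge0 andbT; apply/ler_addgt0Pl => e e0.
rewrite addr0; have [m /(_ x)/ltW] := mass_cyl_small e0; apply: le_trans.
apply: mass_le; [exact: measurable_past1pt|exact: measurable_agree|].
by move=> _ ->.
Qed.

Lemma cdf_allmin : cdf (@allmin n) = 0.
Proof.
rewrite /cdf (_ : mkset _ = [set @allmin n]) ?mass1//.
apply/seteqP; split=> y; last by move=> ->; left.
by move=> yx; apply: lexle_anti yx _; exact: lexle_allmin.
Qed.

Lemma cdf_consecutive x y : consecutive x y -> cdf x = cdf y.
Proof.
move=> [a [s [-> ->]]]; apply/esym/eqP; rewrite -subr_eq0 -mass_lexoc; last first.
  by right; exact: lexlt_below_above.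
rewrite (_ : lexoc _ _ = [set above a s]) ?mass1//.
apply/seteqP; split=> u; first by move=> [/below_lt ua /lexle_anti]; apply.
by move=> ->; split; [exact: lexlt_below_above|left].
Qed.

Lemma cdf_gap m z x y : (forall u, agree m z u -> lexle x u /\ lexle u y) ->
  d ^+ m <= cdf y - cdf x.
Proof.
move=> zu; have [xz zy] := zu z (fun i _ => erefl).
rewrite -mass_lexoc; last exact: lexle_trans zy.
have mx := measurable_past1pt x; have mxy := measurable_lexoc x y.
have /andP[/le_trans-> //] := mass_cyl m z.
rewrite -[leRHS]add0r -(mass1 x) -massU//.
  apply: mass_le => //; [exact: measurable_agree|exact: measurableU|].
  by move=> u /zu[[<-|xu] uy]; [left|right].
by apply/seteqP; split=> // u [-> [/lexlt_irr]].
Qed.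

(** Cylinders have positive mass, so only consecutive pasts are identified.   *)
Lemma cdf_inj x y : lexlt x y -> cdf x = cdf y -> consecutive x y.
Proof.
move=> /lexlt_gap[//|[m [z zu]]] xy.
have : d ^+ m <= cdf y - cdf x.
  by apply: (@cdf_gap m z) => u /zu[? ?]; split; right.
by rewrite xy subrr leNgt exprn_gt0// ltW.
Qed.

Lemma cdf_agree m x y : agree m x y -> `|cdf x - cdf y| <= mass [set u | agree m x u].
Proof.
wlog yx : x y / lexle y x => [wl xy|xy].
  have [/wl|/wl] := lexle_total y x; first by apply.
  rewrite distrC => /(_ (agree_sym xy)) /le_trans; apply; apply: mass_le;
    try exact: measurable_agree.
  by move=> u; exact: agree_trans.
rewrite -mass_lexoc// ger0_norm ?mass_ge0//; apply: mass_le.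
- exact: measurable_lexoc.
- exact: measurable_agree.
- move=> u [yu ux].
  exact: agree_trans xy (agree_between (agree_sym xy) (or_intror yu) ux).
Qed.

End DistributionFunction.

Section DistributionFunctionLaw.
Context {R : realType} {n : nat} {mu : probability (past n) R}.
Context {p : 'I_n.+1 -> past n -> R} {d : R}.
Hypothesis dis : disintegrated mu p d.
Notation F := (cdf mu).

Let brackets t m z := F (cylmin m z) <= t <= F (cylmax m z).

(** The cylinders of length m + 1 inside a cylinder of length m are           *)
(** consecutive, so their images under the distribution function cover.       *)
Let refine_bracket t m z : brackets t m z ->
  exists z', agree m z z' /\ brackets t m.+1 z'.
Proof.
move=> /andP[zt tz].
pose w (a : 'I_n.+1) : past n := fun i => if i == m then a else z i.
have zw a : agree m z (w a) by move=> i im; rewrite /w ltn_eqF.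
have minE : cylmin m.+1 (w ord0) = cylmin m z.
  apply/funext => i; rewrite /cylmin /w ltnS.
  by case: ltngtP.
have maxE : cylmax m.+1 (w ord_max) = cylmax m z.
  apply/funext => i; rewrite /cylmax /w ltnS.
  by case: ltngtP.
have ex : exists k, (k <= n)%N && (t <= F (cylmax m.+1 (w (inord k)))).
  exists n; rewrite leqnn (_ : inord n = ord_max) ?maxE//.
  by apply: val_inj; rewrite /= inordK.
case: (ex_minnP ex) => -[|k] /andP[kn tk] mink.
  exists (w (inord 0)); split; first exact: zw.
  rewrite /brackets tk andbT (_ : inord 0 = ord0) ?minE//.
  by apply: val_inj; rewrite /= inordK.
exists (w (inord k.+1)); split; first exact: zw.
rewrite /brackets tk andbT.
have : ~~ (t <= F (cylmax m.+1 (w (inord k)))).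
  by apply/negP => tk'; have := mink k; rewrite tk' (ltnW kn) ltnn => /(_ isT).
rewrite -ltNge => /ltW; apply: le_trans.
rewrite (@cdf_consecutive _ _ _ _ _ dis (cylmax m.+1 (w (inord k)))
   (cylmin m.+1 (w (inord k.+1))))//.
exists (Ordinal kn), (mkseq z m); rewrite /below /above.
split; apply/funext => i; rewrite /cylmax /cylmin /w pushsE size_rcons size_mkseq;
  case: ifP => // im; rewrite nth_rcons size_mkseq;
  case: (ltngtP i m) im => [im _|mi|-> _].
- by rewrite nth_mkseq.
- by rewrite ltnS leqNgt mi.
- by apply: val_inj; rewrite /= inordK// ltnS ltnW.
- by rewrite nth_mkseq.
- by rewrite ltnS leqNgt mi.
- by apply: val_inj; rewrite /= inordK.
Qed.

(** Successive refinements determine a past one symbol at a time; the images  *)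
(** of its cylinders contain t and shrink to a point.                         *)
Lemma cdf_onto t : 0 <= t <= 1 -> exists x, F x = t.
Proof.
move=> t01.
have step (q : nat * past n) : exists z', brackets t q.1 q.2 ->
    agree q.1 q.2 z' /\ brackets t q.1.+1 z'.
  have [/refine_bracket[z' ?]|?] := pselect (brackets t q.1 q.2); first by exists z'.
  by exists q.2.
have [f fP] := choice step.
pose z := fix z k : past n := if k is k'.+1 then f (k', z k') else @allmin n.
have zb k : brackets t k (z k).
  elim: k => [|k IH]; last exact: (fP (k, z k) IH).2.
  rewrite /brackets (_ : cylmin 0 _ = @allmin n)// (_ : cylmax 0 _ = @allmax n)//.
  by rewrite (cdf_allmin dis) cdf_allmax.
have zS k : agree k (z k) (z k.+1) by exact: (fP (k, z k) (zb k)).1.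
have za k l : (k <= l)%N -> agree k (z k) (z l).
  elim: l => [|l IH]; first by rewrite leqn0 => /eqP ->.
  rewrite leq_eqVlt ltnS => /orP[/eqP -> //|kl].
  exact: (agree_trans (IH kl) (agreeW kl (zS l))).
pose x : past n := fun i => z i.+1 i.
have zx k : agree k (z k) x by move=> i ik; rewrite /x -(za _ _ ik).
exists x; apply/eqP; rewrite -subr_eq0 -normr_le0; apply/ler_addgt0Pl => e e0.
rewrite addr0; have [m me] := mass_cyl_small dis e0.
have /andP[lo up] := zb m.
have mx : F (cylmin m (z m)) <= F x by apply/cdf_le/cylmin_le/zx.
have xm : F x <= F (cylmax m (z m)) by apply/cdf_le/le_cylmax/zx.
have : `|F (cylmin m (z m)) - F (cylmax m (z m))| <= e.
  apply: le_trans (ltW (me (cylmin m (z m)))); apply: cdf_agree.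
  exact: (agree_trans (agree_sym (agree_cylmin m (z m))) (agree_cylmax m (z m))).
by rewrite !ler_norml; lra.
Qed.

Lemma cdf_eq_exceptional x y : F x = F y -> x <> y ->
  exceptional x /\ exceptional y.
Proof.
move=> xy nxy; have [//||] := lexlt_total x y.
- move=> /(cdf_inj dis)/(_ xy)[a [s [-> ->]]].
  by split; exists a, s; [left|right].
- move=> /(cdf_inj dis)/(_ (esym xy))[a [s [-> ->]]].
  by split; exists a, s; [right|left].
Qed.

Lemma measurable_countable (A : set (past n)) : countable A -> measurable A.
Proof. by apply: countable_measurable => t; exact: measurable_past1pt. Qed.

Lemma mass_countable (A : set (past n)) : countable A -> mass mu A = 0.
Proof.
move=> cA; have mA := measurable_countable cA; move/countable_injP: cA => [f injf].
pose E k := A `&` f @^-1` [set k].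
have sub1 k : exists x, E k `<=` [set x].
  have [[x [Ax fx]]|nE] := pselect (exists x, E k x).
    by exists x => y [Ay fy]; apply: injf; rewrite ?inE// fx fy.
  by exists (@allmin n) => y Ey; case: nE; exists y.
have mE k : measurable (E k).
  have [x Ex] := sub1 k; apply: measurable_countable.
  exact: sub_countable (subset_card_le Ex) (countable1 x).
have muE k : mu (E k) = 0%E.
  have [x Ex] := sub1 k; apply/eqP; rewrite eq_le measure_ge0 andbT.
  have <- : mu [set x] = 0%E.
    by rewrite (massE mu (measurable_past1pt x)) (mass1 dis).
  by apply: le_measure; rewrite ?inE//; exact: measurable_past1pt.
rewrite (_ : A = \bigcup_k E k).
  rewrite /mass (measure_semi_bigcup) //; last 2 first.
    by move=> i j _ _ [x [[_ <-] [_ <-]]].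
    exact: bigcupT_measurable.
  by rewrite eseries0// => i _ _; exact: muE.
by apply/seteqP; split=> [x Ax|x [k _ []]//]; exists (f x).
Qed.

(** Sublevel sets are lower intervals, up to points of the exceptional set.   *)
Let sublevel x : let N := [set u | F u <= F x] `&` @exceptional n `\` [set u | lexle u x] in
  countable N /\ [set u | F u <= F x] = [set u | lexle u x] `|` N.
Proof.
move=> N; split.
  apply: sub_countable (@countable_exceptional n).
  by apply: subset_card_le => u [[]].
apply/seteqP; split=> u; last by move=> [/cdf_le|[[]]]; exact.
move=> /= ux; have [|nux] := pselect (lexle u x); [by left|right].
split=> //; split=> //.
have xu : lexlt x u by apply/lexltNge.
have E : F u = F x by apply/eqP; rewrite eq_le ux cdf_le//; right.
by have [] := cdf_eq_exceptional E; first by move=> uE; rewrite uE in nux; case: nux; left.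
Qed.

Lemma measurable_sublevel t : measurable [set u | F u <= t].
Proof.
have [t0|t0] := ltP t 0.
  rewrite (_ : mkset _ = set0)//; apply/seteqP; split=> // u /=.
  by have /andP[+ _] := cdf_itv mu u; lra.
have [t1|t1] := leP t 1; last first.
  rewrite (_ : mkset _ = setT)//; apply/seteqP; split=> // u _ /=.
  by have /andP[_] := cdf_itv mu u; lra.
have [x <-] := @cdf_onto t (introT andP (conj t0 t1)).
have [cN ->] := sublevel x; apply: measurableU; first exact: measurable_lexle.
exact: measurable_countable.
Qed.

Lemma measurable_cdf : measurable_fun setT (F : past n -> R).
Proof.
move=> mD; apply: (measurability _ (RGenOInfty.measurableE R)) => //.
move=> _ [_ [t ->] <-]; rewrite setTI.
rewrite (_ : _ @^-1` _ = ~` [set u | F u <= t]).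
  by apply: measurableC; exact: measurable_sublevel.
by apply/seteqP; split=> u /=; rewrite in_itv /= andbT ltNge => /negP.
Qed.

Lemma mass_sublevel t : 0 <= t <= 1 -> mass mu [set u | F u <= t] = t.
Proof.
move=> /cdf_onto[x <-]; have [cN ->] := sublevel x.
rewrite massU ?(mass_countable cN) ?addr0//.
- exact: measurable_lexle.
- exact: measurable_countable.
- by rewrite setDE setICA setICr setI0.
Qed.

Let cdf_mixin :=
  isMeasurableFun.Build _ _ (past n) (measurableTypeR R) F measurable_cdf.
Let cdf_rv : {mfun past n >-> measurableTypeR R} :=
  HB.pack (F : past n -> measurableTypeR R) cdf_mixin.

(** Under mu, the distribution function is uniformly distributed: its law and *)
(** the Lebesgue measure of the unit interval agree on half-lines.            *)
Lemma cdf_law (B : set R) : measurable B ->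
  mu (F @^-1` B) = lebesgue_measure (B `&` Omega).
Proof.
have mO : measurable (@Omega R) by exact: measurable_itv.
move=> mB; rewrite -[LHS]/(distribution mu cdf_rv B).
rewrite -[RHS]/(mrestr lebesgue_measure mO B).
pose m1 : {measure set (measurableTypeR R) -> \bar R} := distribution mu cdf_rv.
pose m2 : {measure set (measurableTypeR R) -> \bar R} := mrestr lebesgue_measure mO.
apply: (@measure_unique _ R (measurableTypeR R) (@RGenOInfty.G R)
  (fun k => `](- k%:R), +oo[%classic) _ _ _ _ m1 m2 _ _ B mB).
- exact: RGenOInfty.measurableE.
- move=> _ _ [x ->] [y ->]; exists (Num.max x y); apply/seteqP; split=> z /=.
    by rewrite !in_itv /= !andbT gt_max => -[-> ->].
  by rewrite !in_itv /= !andbT gt_max => /andP.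
- by move=> k; exists (- k%:R).
- apply/seteqP; split=> // x _; exists (Num.truncn `|x|).+1 => //=.
  rewrite in_itv /= andbT ltrNl (le_lt_trans _ (truncnS_gt _))//.
  by rewrite (le_trans (ler_norm _))// normrN.
- move=> _ [t ->]; rewrite /m1 /m2 /= /mrestr /Omega /distribution /pushforward.
  have E : F @^-1` `]t, +oo[ = ~` [set u | F u <= t].
    by apply/seteqP; split=> u /=; rewrite in_itv /= andbT ltNge => /negP.
  have [t0|t0] := ltP t 0.
    rewrite (_ : F @^-1` _ = setT) ?probability_setT; last first.
      apply/seteqP; split=> // u _ /=; rewrite in_itv /= andbT (lt_le_trans t0)//.
      by case/andP: (cdf_itv mu u).
    rewrite (_ : _ `&` _ = `[0, 1]%classic).
      by rewrite lebesgue_measure_itv /= lte_fin ltr01 oppr0 adde0.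
    apply/seteqP; split=> x /=; rewrite !in_itv /= ?andbT; first by case.
    move=> /andP[x0 x1]; by rewrite (lt_le_trans t0 x0) x0 x1.
  have [t1|t1] := leP t 1; last first.
    rewrite (_ : F @^-1` _ = set0) ?measure0; last first.
      apply/seteqP; split=> // u /=; rewrite in_itv /= andbT.
      by have /andP[_] := cdf_itv mu u; lra.
    rewrite (_ : _ `&` _ = set0) ?measure0//.
    by apply/seteqP; split=> // x /= []; rewrite !in_itv /=; lra.
  rewrite E probability_setC; last exact: measurable_sublevel.
  rewrite massE ?mass_sublevel ?t0//; last exact: measurable_sublevel.
  rewrite (_ : _ `&` _ = `]t, 1]%classic).
    rewrite lebesgue_measure_itv /= lte_fin lt_neqAle t1 andbT.
    by have [->|_] := eqVneq t 1; rewrite /= -EFinB ?subrr.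
  apply/seteqP; split=> x /=; rewrite !in_itv /= ?andbT; first by move=> [-> /andP[]].
  by move=> /andP[tx ->]; rewrite tx (le_trans t0 (ltW tx)).
- move=> k; apply: le_lt_trans (ltry 1); exact: probability_le1.
Qed.

End DistributionFunctionLaw.

(** * Limits along subsets of the line *)

Section Limits.
Context {R : realType}.
Implicit Types (D : set R) (f g : R -> R).

Lemma cvg_withinP D f x l : f @ within D (nbhs x) --> l <->
  forall e, 0 < e -> exists2 r, 0 < r &
    forall y, D y -> `|y - x| < r -> `|f y - l| < e.
Proof.
split=> [/cvgrPdist_lt fl e e0|fl].
  have [r /= r0 rP] := fl _ e0; exists r => // y Dy yx.
  by rewrite distrC; apply: rP => //=; rewrite distrC.
apply/cvgrPdist_lt => e e0; have [r r0 rP] := fl e e0; exists r => //= y yx Dy.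
by rewrite distrC; apply: rP; rewrite // distrC.
Qed.

Lemma within_continuousP D f : {within D, continuous f} <->
  forall x, D x -> forall e, 0 < e -> exists2 r, 0 < r &
    forall y, D y -> `|y - x| < r -> `|f y - f x| < e.
Proof.
rewrite subspace_continuousP; split=> fc x Dx; first exact/cvg_withinP/fc.
exact/cvg_withinP/fc.
Qed.

Lemma deriv_withinP D g x l : deriv_within D g x l <->
  forall e, 0 < e -> exists2 r, 0 < r &
    forall y, D y -> y != x -> `|y - x| < r -> `|diff_quotient g x y - l| < e.
Proof.
split=> [/cvgrPdist_lt gl e e0|gl].
  have [r /= r0 rP] := gl _ e0; exists r => // y Dy yx xyr.
  by rewrite distrC; apply: rP => //=; rewrite distrC.
apply/cvgrPdist_lt => e e0; have [r r0 rP] := gl e e0.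
exists r => //= y xyr yx Dy.
by rewrite distrC; apply: rP; rewrite // distrC.
Qed.

Lemma left_derivP g x l : left_deriv g x l <-> deriv_within [set y | y < x] g x l.
Proof.
rewrite deriv_withinP; split=> [/cvg_withinP gl e e0|gl].
  by have [r r0 rP] := gl _ e0; exists r => // y yx _; exact: rP.
apply/cvg_withinP => e e0; have [r r0 rP] := gl e e0.
by exists r => // y yx; apply: rP => //; rewrite lt_eqF.
Qed.

Lemma right_derivP g x l : right_deriv g x l <-> deriv_within [set y | x < y] g x l.
Proof.
rewrite deriv_withinP; split=> [/cvg_withinP gl e e0|gl].
  by have [r r0 rP] := gl _ e0; exists r => // y yx _; exact: rP.
apply/cvg_withinP => e e0; have [r r0 rP] := gl e e0.
by exists r => // y yx; apply: rP => //; rewrite gt_eqF.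
Qed.

(** Two continuous functions on an open set that agree off a countable set    *)
(** are equal: a non-empty interval is not countable.                         *)
Lemma continuous_eq_countable D f g (N : set R) : open D -> countable N ->
  {within D, continuous f} -> {within D, continuous g} ->
  (forall x, D x -> ~ N x -> f x = g x) -> forall x, D x -> f x = g x.
Proof.
move=> oD cN /within_continuousP fc /within_continuousP gc fg x Dx.
apply/eqP/negPn/negP => nfg.
have e0 : 0 < `|f x - g x| / 2 by rewrite divr_gt0// normr_gt0 subr_eq0.
have [r r0 rP] := fc x Dx _ e0; have [s s0 sP] := gc x Dx _ e0.
have [t /= t0 tD] : nbhs x D by exact: open_nbhs_nbhs.
pose m := Num.min r (Num.min s t).
have m0 : 0 < m by rewrite !lt_min r0 s0.
have sub : ball x m `<=` N.
  move=> y; rewrite /ball /= distrC !lt_min => /and3P[yr ys yt].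
  have Dy : D y by apply: tD; rewrite /= distrC.
  apply: contrapT => Ny; have := rP y Dy yr; have := sP y Dy ys.
  rewrite (fg y Dy Ny) => h1 h2.
  have := ler_normD (f x - g y) (g y - g x).
  by rewrite (distrC (f x) (g y)) addrA subrK; lra.
have mN : measurable N.
  by apply: countable_measurable => // z; exact: measurable_set1.
have : (lebesgue_measure (ball x m) <= lebesgue_measure N)%E.
  by apply: le_measure; rewrite ?inE//; exact: measurable_ball.
rewrite (lebesgue_measure_ball _ (ltW m0)) countable_lebesgue_measure0//.
by rewrite lee_fin -mulr_natr; lra.
Qed.

End Limits.

(** * The branches of the interval map *)

Section Branches.
Context {R : realType} {n : nat} {P : probability (words int n) R}.
Context {p : 'I_n.+1 -> past n -> R} {d : R}.
Hypothesis dis : disintegrated (past_law P) p d.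
Notation F := (h P).
Implicit Types (x y : past n) (j : 'I_n.+1) (v w : R) (T : R -> R).

Lemma hE : F = cdf (past_law P).
Proof. by []. Qed.

Let d_gt0 : 0 < d. Proof. by case: dis. Qed.

Lemma h_le x y : lexle x y -> F x <= F y.
Proof. exact: (@cdf_le _ _ (past_law P)). Qed.

Lemma h_lt x y : F x < F y -> lexlt x y.
Proof. exact: (@cdf_lt _ _ (past_law P)). Qed.

Lemma h_itv x : 0 <= F x <= 1.
Proof. exact: (cdf_itv (past_law P)). Qed.

Lemma h_allmin : F (@allmin n) = 0.
Proof. exact: (cdf_allmin dis). Qed.

Lemma h_allmax : F (@allmax n) = 1.
Proof. exact: (cdf_allmax (past_law P)). Qed.

Lemma h_onto w : 0 <= w <= 1 -> exists x, F x = w.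
Proof. exact: (cdf_onto dis). Qed.

Lemma h_consecutive x y : consecutive x y -> F x = F y.
Proof. exact: (cdf_consecutive dis). Qed.

Lemma h_push_lip j x y : lexle x y ->
  d * (F y - F x) <= F (push j y) - F (push j x) <= F y - F x.
Proof. exact: (cdf_push_lip dis). Qed.

Lemma hinvK w : Omega w -> F (hinv P w) = w.
Proof.
move=> /=; rewrite /Omega /= in_itv /= => w01; rewrite /hinv pinvK// inE.
by have [x xw] := h_onto w01; exists x.
Qed.

Lemma Omega_h x : Omega (F x).
Proof. by rewrite /Omega /= in_itv; exact: (cdf_itv (past_law P)). Qed.

Lemma eta_min j : eta P j = F (push j (@allmin n)).
Proof.
rewrite /eta; case: eqP => [j0|/eqP j0].
  rewrite -[LHS]h_allmin; congr h; apply/funext => -[|i] //=.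
  by apply: val_inj.
rewrite ltn_eqF//; apply: h_consecutive.
have jn : (j.-1 < n)%N by rewrite prednK ?lt0n// -ltnS.
exists (Ordinal jn), [::]; rewrite /below /above /=; split; congr push; apply: val_inj => /=.
  by rewrite inordK// ltnW.
by rewrite /bump /= add1n prednK// lt0n.
Qed.

Lemma eta_max j : eta P j.+1 = F (push j (@allmax n)).
Proof.
rewrite /eta /=; case: eqP => [[jn]|jn].
  rewrite -[LHS]h_allmax; congr h; apply/funext => -[|i] //=.
  by apply: val_inj.
by rewrite inord_val.
Qed.

Lemma eta_lt j : eta P j < eta P j.+1.
Proof.
rewrite eta_min eta_max -subr_gt0.
have /andP[+ _] := h_push_lip j (lexle_allmin (@allmax n)).
by apply: lt_le_trans; rewrite h_allmax h_allmin subr0 mulr1.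
Qed.

Lemma h_push_itv j x : eta P j <= F (push j x) <= eta P j.+1.
Proof.
rewrite eta_min eta_max; apply/andP.
by split; apply/h_le/lexle_push; [exact: lexle_allmin|exact: lexle_allmax].
Qed.

Lemma branch_closureP j w : branch_closure P j w -> exists x, w = F (push j x).
Proof.
rewrite /branch_closure /= in_itv /= => /andP[jw wj].
have w01 : 0 <= w <= 1.
  move: jw wj; rewrite eta_min eta_max => jw /le_trans -> //.
    by rewrite (le_trans _ jw)//; case/andP: (h_itv (push j (@allmin n))).
  by case/andP: (h_itv (push j (@allmax n))).
have [x xw] := h_onto w01; have [xj|jx|xj] := ltngtP (x 0%N) j.
- exists (@allmin n); apply/eqP; rewrite eq_le -eta_min jw andbT eta_min -xw.
  by apply: h_le; right; exact: lexlt_head.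
- exists (@allmax n); apply/eqP; rewrite eq_le -eta_max wj eta_max -xw.
  by apply: h_le; right; exact: lexlt_head.
- by exists (drop_last x); rewrite -(val_inj xj) push_eta.
Qed.

(** The map h o S o h^-1 on the closed interval number j. Requiring the last  *)
(** symbol of the preimage to be j singles out the correct one at the end     *)
(** points; inside the interval all preimages give the same value.            *)
Definition branch_map j w : R :=
  F (drop_last (xget (push j (@allmin n)) [set x | x 0%N = j /\ F x = w])).

Lemma h_push_eq j x y : F (push j x) = F (push j y) <-> F x = F y.
Proof.
wlog xy : x y / lexle x y => [wl|].
  by have [/wl//|/wl yx] := lexle_total x y; split=> /esym /yx.
have /andP[lo up] := h_push_lip j xy.
split=> E; apply/eqP; rewrite eq_le h_le//=.
  move: lo; rewrite E subrr pmulr_rle0// subr_le0.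
  exact.
by move: up; rewrite E subrr subr_le0.
  exact: lexle_push1.
Qed.

Lemma branch_mapE j x : branch_map j (F (push j x)) = F x.
Proof.
rewrite /branch_map; case: xgetP => [y _ [y0 yx]|/(_ (push j x))[]//].
by apply/(h_push_eq j); rewrite -yx -y0 push_eta.
Qed.

Lemma h_push_lt j x y : (F (push j x) < F (push j y)) = (F x < F y).
Proof.
have H (u v : past n) : F u < F v -> F (push j u) < F (push j v).
  move=> uv; rewrite lt_neqAle; apply/andP; split.
    by apply: contraL uv => /eqP/(h_push_eq j) ->; rewrite ltxx.
  by rewrite h_le//; apply: lexle_push1; right; exact: h_lt uv.
apply/idP/idP; last exact: H.
rewrite !ltNge; apply: contra; rewrite le_eqVlt => /orP[/eqP yx|/H/ltW//].
by rewrite ((h_push_eq j y x).2 yx).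
Qed.

(** The branches expand by at most 1 / d, since p is at least d.              *)
Lemma branch_map_lip j v w : branch_closure P j v -> branch_closure P j w ->
  `|branch_map j v - branch_map j w| <= d^-1 * `|v - w|.
Proof.
move=> /branch_closureP[x ->] /branch_closureP[y ->]; rewrite !branch_mapE.
wlog xy : x y / lexle x y => [wl|].
  have [/wl//|/wl] := lexle_total x y.
  by rewrite distrC (distrC (F (push j y))).
rewrite ler_pdivlMl//.
have /andP[lo _] := h_push_lip j xy.
rewrite distrC (distrC (F (push j x))) !ger0_norm ?subr_ge0 ?h_le//.
exact: lexle_push1.
Qed.

Lemma branch_map_continuous j : {within branch_closure P j, continuous (branch_map j)}.
Proof.
apply/within_continuousP => x jx e e0; exists (d * e); first by rewrite mulr_gt0.
move=> y jy yx; apply: le_lt_trans (branch_map_lip jy jx) _.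
by rewrite ltr_pdivrMl.
Qed.

Lemma branch_sub_closure j : branch P j `<=` branch_closure P j.
Proof. by apply: subset_itvW. Qed.

Lemma branch_open j : open (branch P j).
Proof. exact: interval_open. Qed.

Lemma branch_first j x : branch P j (F x) -> x 0%N = j.
Proof.
rewrite /branch /= in_itv /= eta_min eta_max => /andP[/h_lt jx /h_lt xj].
apply/val_inj/eqP; rewrite eqn_leq.
by rewrite (lexle_head (or_intror xj)) (lexle_head (or_intror jx)).
Qed.

Lemma branchP j w : branch P j w ->
  exists2 x, w = F (push j x) & 0 < F x < 1.
Proof.
move=> jw; have [x wx] := branch_closureP (branch_sub_closure jw).
exists x => //; move: jw; rewrite wx /branch /= in_itv /= eta_min eta_max.
by rewrite !h_push_lt h_allmin h_allmax.
Qed.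

Lemma branch_h_push j x : 0 < F x < 1 -> branch P j (F (push j x)).
Proof.
rewrite /branch /= in_itv /= eta_min eta_max.
by rewrite !h_push_lt h_allmin h_allmax.
Qed.

Lemma branch_Omega j w : branch P j w -> Omega w.
Proof. by move=> /branchP[x -> _]; exact: Omega_h. Qed.

Lemma T0_branch j w : branch P j w -> T0 P w = branch_map j w.
Proof.
move=> jw; have wE := hinvK (branch_Omega jw).
have hj : hinv P w 0%N = j by apply: branch_first; rewrite wE.
by rewrite /T0 /= -{2}wE -(push_eta (hinv P w)) hj branch_mapE.
Qed.

Lemma continuous_extension_T0 : continuous_extension P (T0 P).
Proof.
split=> // j; apply: (@subspace_eq_continuous _ _ _ (branch_map j)).
  by move=> w; rewrite inE => /T0_branch.
exact: continuous_subspaceW (@branch_sub_closure j) (@branch_map_continuous j).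
Qed.

(** Both functions are continuous and agree off the countable set of images   *)
(** of exceptional pasts.                                                     *)
Lemma extension_branch T j w : continuous_extension P T -> branch P j w ->
  T w = branch_map j w.
Proof.
move=> [TE Tc]; apply: (@continuous_eq_countable _ _ _ _ (F @` @exceptional n)).
- exact: branch_open.
- exact: sub_countable (card_image_le _ _) countable_exceptional.
- exact: Tc.
- exact: continuous_subspaceW (@branch_sub_closure j) (@branch_map_continuous j).
- by move=> v jv Nv; rewrite TE//; [exact: T0_branch|exact: branch_Omega jv].
Qed.

Lemma extension_h_push T j x : continuous_extension P T -> 0 < F x < 1 ->
  T (F (push j x)) = F x.
Proof.
by move=> cT x01; rewrite (extension_branch cT (branch_h_push j x01)) branch_mapE.
Qed.

End Branches.

Arguments branch_map {R n} P j w.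

(** * Derivatives *)

Lemma deriv_within_transfer (R : realType) (D D' : set R) (f g : R -> R) (x l : R) :
  (exists2 r, 0 < r &
     forall y, D' y -> y != x -> `|y - x| < r -> D y /\ f y = g y) ->
  f x = g x -> deriv_within D g x l -> deriv_within D' f x l.
Proof.
move=> [s s0 sP] fgx /deriv_withinP gl; apply/deriv_withinP => e e0.
have [r r0 rP] := gl e e0; exists (Num.min r s); first by rewrite lt_min r0.
move=> y Dy yx; rewrite lt_min => /andP[yr ys].
by have [Dy' fgy] := sP y Dy yx ys; rewrite /diff_quotient fgx fgy; exact: rP.
Qed.

Arguments deriv_within_transfer {R D D' f g x l} _ _ _ t _.

Section ExtremePasts.
Context {n : nat}.
Implicit Types x : past n.

Lemma ev_minP x : ev_min x -> x = @allmin n \/ exists a s, x = above a s.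
Proof.
move=> [m]; elim: m x => [|m IH] x xm.
  by left; apply/funext => i; rewrite xm.
rewrite -(push_eta x); have [->|[a [s ->]]] := IH (drop_last x) (fun i => xm i.+1).
  have [->|x0] := eqVneq (x 0%N) ord0; first by left; apply/funext; case.
  have xn : ((x 0%N).-1 < n)%N by rewrite prednK ?lt0n// -ltnS.
  right; exists (Ordinal xn), [::]; rewrite /above /=; congr push.
  by apply: val_inj; rewrite /= /bump add1n prednK// lt0n.
by right; exists a, (x 0%N :: s).
Qed.

Lemma ev_maxP x : ev_max x -> x = @allmax n \/ exists a s, x = below a s.
Proof.
move=> [m]; elim: m x => [|m IH] x xm.
  by left; apply/funext => i; rewrite xm.
rewrite -(push_eta x); have [->|[a [s ->]]] := IH (drop_last x) (fun i => xm i.+1).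
  have [->|x0] := eqVneq (x 0%N) ord_max; first by left; apply/funext; case.
  have xn : (x 0%N < n)%N.
    rewrite ltn_neqAle -ltnS ltn_ord andbT.
    by apply: contra x0 => /eqP x0; apply/eqP/val_inj.
  right; exists (Ordinal xn), [::]; rewrite /below /=; congr push.
  exact: val_inj.
by right; exists a, (x 0%N :: s).
Qed.

Lemma ev_max_min x : (0 < n)%N -> ev_max x -> ~ ev_min x.
Proof.
move=> n0 [m xm] [k xk]; have := xm _ (leq_maxl m k).
rewrite xk ?leq_maxr// => /(congr1 val)/= E; by rewrite -E in n0.
Qed.

Lemma ev_min_push b x : ev_min (push b x) <-> ev_min x.
Proof.
split=> -[m xm]; last by exists m.+1 => -[|i] mi; [|exact: xm].
by exists m => i mi; exact: (xm i.+1 (leqW mi)).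
Qed.

Lemma ev_max_push b x : ev_max (push b x) <-> ev_max x.
Proof.
split=> -[m xm]; last by exists m.+1 => -[|i] mi; [|exact: xm].
by exists m => i mi; exact: (xm i.+1 (leqW mi)).
Qed.

End ExtremePasts.

Section Slopes.
Context {R : realType} {n : nat} {P : probability (words int n) R}.
Context {p : 'I_n.+1 -> past n -> R} {d : R}.
Hypothesis dis : disintegrated (past_law P) p d.
Notation F := (h P).
Implicit Types (x y : past n) (j : 'I_n.+1) (v w : R) (T : R -> R).

Let n_gt0 : (0 < n)%N. Proof. by case: dis. Qed.
Let d_gt0 : 0 < d. Proof. by case: dis. Qed.
Let dp a x : d <= p a x. Proof. by case: dis. Qed.

Lemma h_cylmin_lt m x : ~ ev_min x -> F (cylmin m x) < F x.
Proof.
move=> nx; have := cylmin_lt m nx => xx.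
rewrite lt_neqAle h_le ?andbT; last by right.
apply/eqP => /(cdf_inj dis xx) [a [s [_ xE]]].
by apply: nx; rewrite xE; exact: ev_min_above.
Qed.

Lemma h_lt_cylmax m x : ~ ev_max x -> F x < F (cylmax m x).
Proof.
move=> nx; have := lt_cylmax m nx => xx.
rewrite lt_neqAle h_le ?andbT; last by right.
apply/eqP => /(cdf_inj dis xx) [a [s [xE _]]].
by apply: nx; rewrite xE; exact: ev_max_below.
Qed.

(** A past that is not eventually minimal is approached from the left, in the *)
(** sense of cylinders, by all pasts whose images are close on the left.      *)
Lemma agree_left m x : ~ ev_min x -> exists2 r, 0 < r &
  forall y, lexle y x -> F x - F y < r -> agree m x y.
Proof.
move=> nx; exists (F x - F (cylmin m x)); first by rewrite subr_gt0 h_cylmin_lt.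
move=> y yx; rewrite ltrD2l ltrN2 => /h_lt xy.
apply: (agree_trans (agree_cylmin m x)).
exact: (agree_between (agree_sym (agree_cylmin m x)) (or_intror xy) yx).
Qed.

Lemma agree_right m x : ~ ev_max x -> exists2 r, 0 < r &
  forall y, lexle x y -> F y - F x < r -> agree m x y.
Proof.
move=> nx; exists (F (cylmax m x) - F x); first by rewrite subr_gt0 h_lt_cylmax.
move=> y xy; rewrite ltrD2r => /h_lt yx.
exact: (agree_between (agree_cylmax m x) xy (or_intror yx)).
Qed.

Definition between x y u := (lexle x u /\ lexle u y) \/ (lexle y u /\ lexle u x).

Lemma between_sym x y u : between x y u -> between y x u.
Proof. by case; [right|left]. Qed.

(** Form of cdf_push_between that does not depend on the order of x and y.    *)
Lemma h_push_slope j x y c e : (forall u, between x y u -> `|p j u - c| <= e) ->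
  `|F (push j y) - F (push j x) - c * (F y - F x)| <= e * `|F y - F x|.
Proof.
wlog xy : x y / lexle x y => [wl|] ce.
  have [/wl/(_ ce)//|/wl] := lexle_total x y.
  move=> /(_ (fun u yxu => ce u (between_sym yxu))); rewrite (distrC (F x)).
  have -> : F (push j y) - F (push j x) - c * (F y - F x) =
    - (F (push j x) - F (push j y) - c * (F x - F y)) by ring.
  by rewrite normrN.
have bnd u : lexlt x u -> lexle u y -> c - e <= p j u <= c + e.
  move=> xu uy; have := ce u (or_introl (conj (or_intror xu) uy)).
  by rewrite ler_distlC => /andP[? ?]; apply/andP; split; lra.
have /andP[lo up] := cdf_push_between dis xy bnd.
rewrite (ger0_norm (_ : 0 <= F y - F x)) ?subr_ge0 ?h_le//.
by rewrite ler_norml; apply/andP; split; move: lo up; rewrite -/(h P _) hE; nra.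
Qed.

Lemma h_push_expand j x y :
  d * `|F y - F x| <= `|F (push j y) - F (push j x)|.
Proof.
wlog xy : x y / lexle x y => [wl|].
  have [/wl//|/wl] := lexle_total x y.
  by rewrite distrC (distrC (F (push j x))).
have /andP[+ _] := h_push_lip dis j xy.
by rewrite !ger0_norm// subr_ge0 h_le//; exact: lexle_push1.
Qed.

(** With D the increment of branch_map and N that of its argument, N is close *)
(** to p(j | x) D. The error is divided by N p(j | x), where N is at least    *)
(** d D and p(j | x) at least d, whence the factor 1 / d ^+ 2.                *)
Lemma diff_quotient_branch j x y e : F y != F x ->
  (forall u, between x y u -> `|p j u - p j x| <= e) ->
  `|diff_quotient (branch_map P j) (F (push j x)) (F (push j y)) - 1 / p j x|
    <= e / d ^+ 2.
Proof.
move=> yx /h_push_slope; rewrite /diff_quotient !(branch_mapE dis).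
set D := F y - F x; set N := F (push j y) - F (push j x) => ND.
have D0 : 0 < `|D| by rewrite normr_gt0 subr_eq0.
have dN : d * `|D| <= `|N| by exact: h_push_expand.
have px : 0 < p j x by exact: lt_le_trans (dp j x).
have N0 : 0 < `|N| by apply: lt_le_trans dN; rewrite mulr_gt0.
have pn0 : p j x != 0 by rewrite gt_eqF.
have Nn0 : N != 0 by rewrite -normr_gt0.
have -> : D / N - 1 / p j x = - ((N - p j x * D) / (N * p j x)).
  by field; rewrite pn0 Nn0.
rewrite normrN normrM normfV ler_pdivrMr; last by rewrite normr_gt0 mulf_neq0.
have e0 : 0 <= e by rewrite -(pmulr_lge0 _ D0) (le_trans _ ND).
apply: (le_trans ND); rewrite normrM (gtr0_norm px).
have -> : e * `|D| = e / d ^+ 2 * (d * `|D| * d) by field; rewrite gt_eqF.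
apply: ler_wpM2l; first by rewrite divr_ge0// exprn_ge0// ltW.
by apply: ler_pM => //; rewrite ?mulr_ge0// ltW.
Qed.

Hypothesis unif : forall e, 0 < e ->
  exists m, forall j x y, agree m x y -> `|p j x - p j y| <= e.

(** One-sided derivatives follow from the mean value estimate as soon as the  *)
(** pasts involved agree with x on many symbols.                              *)
Lemma deriv_branch_agree j x (D : set R) :
  (forall m, exists2 r, 0 < r &
     forall y, D (F (push j y)) -> `|F y - F x| < r -> F y != F x -> agree m x y) ->
  D `<=` branch_closure P j ->
  deriv_within D (branch_map P j) (F (push j x)) (1 / p j x).
Proof.
move=> agD Dj; apply/deriv_withinP => e e0.
have e0' : 0 < e * d ^+ 2 / 2 by rewrite divr_gt0// mulr_gt0// exprn_gt0.
have [m mP] := unif e0'; have [r r0 rP] := agD m.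
exists (d * r) => [|v Dv]; first by rewrite mulr_gt0.
have [y vE] := branch_closureP dis (Dj _ Dv); rewrite {v}vE in Dv * => vx yr.
have yx : F y != F x by apply: contra vx => /eqP/(h_push_eq dis j) ->.
have xy : agree m x y.
  apply: rP => //; rewrite -(ltr_pM2l d_gt0).
  exact: le_lt_trans (h_push_expand _ _ _) yr.
have bnd u : between x y u -> `|p j u - p j x| <= e * d ^+ 2 / 2.
  move=> xyu; rewrite distrC; apply: mP; case: xyu => -[xu uy].
    exact: (agree_between xy xu uy).
  exact: (agree_trans xy (agree_between (agree_sym xy) xu uy)).
apply: le_lt_trans (diff_quotient_branch yx bnd) _.
rewrite mulrAC mulfK ?expf_neq0 ?gt_eqF//.
by rewrite ltr_pdivrMr//; lra.
Qed.

Lemma left_deriv_branch j x : ~ ev_min x ->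
  deriv_within (branch_closure P j `&` [set v | v < F (push j x)])
    (branch_map P j) (F (push j x)) (1 / p j x).
Proof.
move=> nx; apply: deriv_branch_agree; last by move=> v [].
move=> m; have [r r0 rP] := agree_left m nx; exists r => // y [_ /=].
rewrite (h_push_lt dis) => yx yr _; apply: rP; first by right; exact: h_lt yx.
by move: yr; rewrite distrC ger0_norm// subr_ge0 ltW.
Qed.

Arguments left_deriv_branch j {x} _ t _.

Lemma right_deriv_branch j x : ~ ev_max x ->
  deriv_within (branch_closure P j `&` [set v | F (push j x) < v])
    (branch_map P j) (F (push j x)) (1 / p j x).
Proof.
move=> nx; apply: deriv_branch_agree; last by move=> v [].
move=> m; have [r r0 rP] := agree_right m nx; exists r => // y [_ /=].
rewrite (h_push_lt dis) => yx yr _; apply: rP; first by right; exact: h_lt yx.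
by move: yr; rewrite ger0_norm// subr_ge0 ltW.
Qed.

Arguments right_deriv_branch j {x} _ t _.

Lemma h_gt0 x : ~ ev_min x -> 0 < F x.
Proof.
move=> nx; apply: le_lt_trans (h_cylmin_lt 0 nx).
by case/andP: (h_itv (P := P) (cylmin 0 x)).
Qed.

Lemma h_lt1 x : ~ ev_max x -> F x < 1.
Proof.
move=> nx; apply: lt_le_trans (h_lt_cylmax 0 nx) _.
by case/andP: (h_itv (P := P) (cylmax 0 x)).
Qed.

Lemma below_above a s : F (below a s) = F (above a s).
Proof. by apply: (h_consecutive dis); exists a, s. Qed.

Lemma below_not_ev_min (a : 'I_n) s : ~ ev_min (below a s).
Proof. by apply: ev_max_min => //; exact: ev_max_below. Qed.

Lemma above_not_ev_max (a : 'I_n) s : ~ ev_max (above a s).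
Proof. by move=> /(ev_max_min n_gt0); apply; exact: ev_min_above. Qed.

Lemma h_below_itv (a : 'I_n) s : 0 < F (below a s) < 1.
Proof.
rewrite h_gt0; last exact: below_not_ev_min.
by rewrite below_above h_lt1//; exact: above_not_ev_max.
Qed.

(** The image point has two preimages. The one ending with below a s is not   *)
(** eventually minimal and governs the left side, the one ending with above   *)
(** a s is not eventually maximal and governs the right side.                 *)
Lemma one_sided_derivatives T (a : 'I_n) j s : continuous_extension P T ->
  [/\ F (below a (j :: s)) = F (above a (j :: s)),
      left_deriv T (F (below a (j :: s))) (1 / p j (below a s))
    & right_deriv T (F (below a (j :: s))) (1 / p j (above a s))].
Proof.
move=> cT; set x := below a s; set y := above a s.
have -> : below a (j :: s) = push j x by [].
have -> : above a (j :: s) = push j y by [].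
have xy : F (push j x) = F (push j y) by apply/(h_push_eq dis)/below_above.
have jx : branch P j (F (push j x)) by exact/(branch_h_push dis)/h_below_itv.
have [r /= r0 rP] : nbhs (F (push j x)) (branch P j).
  by apply: open_nbhs_nbhs; split => //; exact: branch_open.
have Tr v : `|v - F (push j x)| < r -> branch P j v /\ T v = branch_map P j v.
  move=> vr; have jv : branch P j v by apply: rP; rewrite /= distrC.
  by rewrite (extension_branch dis cT jv).
split => //.
- apply/left_derivP.
  apply: (deriv_within_transfer _ _ (left_deriv_branch j (@below_not_ev_min a s))); last first.
  + exact: (extension_branch dis cT jx).
  exists r => // v vx _ /Tr[jv ->]; split=> //; split=> //.
  exact: branch_sub_closure.
- rewrite xy in jx rP Tr *.
  apply/right_derivP.
  apply: (deriv_within_transfer _ _ (right_deriv_branch j (@above_not_ev_max a s))); last first.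
  + exact: (extension_branch dis cT jx).
  exists r => // v vx _ /Tr[jv ->]; split=> //; split=> //.
  exact: branch_sub_closure.
Qed.

(** At an end point w, a point v of the open interval close to w is obtained  *)
(** by moving from w towards the midpoint c.                                  *)
Lemma branch_extension_closure T j g w : continuous_extension P T ->
  branch_extension P T j g -> branch_closure P j w -> g w = branch_map P j w.
Proof.
move=> cT [gT /within_continuousP gc] jw.
have /within_continuousP bc := @branch_map_continuous _ _ _ _ _ dis j.
have jj := eta_lt dis j.
apply/eqP/negPn/negP => ngb.
have e0 : 0 < `|g w - branch_map P j w| / 2.
  by rewrite divr_gt0// normr_gt0 subr_eq0.
have [r r0 rP] := gc w jw _ e0; have [s s0 sP] := bc w jw _ e0.
have [v [jv vw]] : exists v, branch P j v /\ `|v - w| < Num.min r s.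
  pose c := (eta P j + eta P j.+1) / 2.
  pose t := Num.min (1 / 2) (Num.min r s / (eta P j.+1 - eta P j) / 2).
  have t0 : 0 < t.
    by rewrite lt_min divr_gt0//= divr_gt0// divr_gt0 ?subr_gt0// lt_min r0.
  have t1 : t <= 1 / 2 by rewrite ge_min lexx.
  have tr : t * (eta P j.+1 - eta P j) < Num.min r s.
    apply: (@le_lt_trans _ _ (Num.min r s / 2)); last first.
      by rewrite ltr_pdivrMr// ltr_pMr ?lt_min ?r0// ltr1n.
    have -> : Num.min r s / 2 = Num.min r s / (eta P j.+1 - eta P j) / 2 *
        (eta P j.+1 - eta P j) by field; rewrite subr_eq0 gt_eqF.
    by rewrite ler_wpM2r ?subr_ge0 ?(ltW jj)// /t ge_min lexx orbT.
  move: jw; rewrite /branch_closure /branch /= in_itv /= => /andP[jw wj].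
  exists (w + t * (c - w)); split; last first.
    rewrite addrAC subrr add0r normrM gtr0_norm//; apply: le_lt_trans tr.
    by rewrite ler_pM2l// ler_norml /c; lra.
  by rewrite in_itv /= /c; apply/andP; split; nra.
move: vw; rewrite lt_min => /andP[vr vs].
have jv' := branch_sub_closure jv.
have := sP v jv' vs; have := rP v jv' vr.
rewrite gT ?inE// (extension_branch dis cT jv) => h1 h2.
have := ler_normD (g w - branch_map P j v) (branch_map P j v - branch_map P j w).
by rewrite (distrC (g w)) addrA subrK; lra.
Qed.

Lemma branch_extension_map T j : continuous_extension P T ->
  branch_extension P T j (branch_map P j).
Proof.
move=> cT; split; last exact: (branch_map_continuous dis).
by move=> w; rewrite inE => jw; rewrite (extension_branch dis cT jw).
Qed.

Lemma left_deriv_eta T j g : continuous_extension P T ->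
  branch_extension P T j g ->
  left_deriv g (eta P j.+1) (1 / p j (@allmax n)).
Proof.
move=> cT ge; have jj := eta_lt dis j.
have cl := branch_extension_closure cT ge.
apply/left_derivP; rewrite (eta_max j).
have nx : ~ ev_min (@allmax n) by apply: ev_max_min => //; exists 0%N.
apply: (deriv_within_transfer _ _ (left_deriv_branch j nx)); last first.
- by apply: cl; rewrite -eta_max /branch_closure /= in_itv /= lexx ltW.
exists (eta P j.+1 - eta P j); first by rewrite subr_gt0.
move=> v /= vj _; rewrite -eta_max in vj * => vr.
have jv : branch_closure P j v.
  by rewrite /branch_closure /= in_itv /= (ltW vj) andbT; move: vr; rewrite ltr_norml; lra.
by split; [split|exact: cl].
Qed.

Lemma right_deriv_eta T j g : continuous_extension P T ->
  branch_extension P T j g ->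
  right_deriv g (eta P j) (1 / p j (@allmin n)).
Proof.
move=> cT ge; have jj := eta_lt dis j.
have cl := branch_extension_closure cT ge.
apply/right_derivP; rewrite (eta_min dis j).
have nx : ~ ev_max (@allmin n).
  by move=> /(ev_max_min n_gt0); apply; exists 0%N.
apply: (deriv_within_transfer _ _ (right_deriv_branch j nx)); last first.
- by apply: cl; rewrite -(eta_min dis) /branch_closure /= in_itv /= lexx ltW.
exists (eta P j.+1 - eta P j); first by rewrite subr_gt0.
move=> v /= vj _; rewrite -(eta_min dis) in vj * => vr.
have jv : branch_closure P j v.
  by rewrite /branch_closure /= in_itv /= (ltW vj); move: vr; rewrite ltr_norml; lra.
by split; [split|exact: cl].
Qed.

End Slopes.

Section Derivatives.
Context {R : realType} {n : nat} {P : probability (words int n) R}.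
Context {p : 'I_n.+1 -> past n -> R} {d : R}.
Hypothesis dis : disintegrated (past_law P) p d.
Hypothesis unif : forall e, 0 < e ->
  exists m, forall j x y, agree m x y -> `|p j x - p j y| <= e.
Notation F := (h P).
Implicit Types (x y : past n) (j : 'I_n.+1) (v w : R) (T : R -> R).

Let n_gt0 : (0 < n)%N. Proof. by case: dis. Qed.
Let d_gt0 : 0 < d. Proof. by case: dis. Qed.
Let dp a x : d <= p a x. Proof. by case: dis. Qed.

(** The extreme pasts are allowed because nothing lies beyond them.           *)
Lemma agree_near m x : (ev_min x -> x = @allmin n) -> (ev_max x -> x = @allmax n) ->
  exists2 r, 0 < r & forall y, `|F y - F x| < r -> agree m x y.
Proof.
move=> xmin xmax.
have [r r0 rP] : exists2 r, 0 < r &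
    forall y, lexle y x -> `|F y - F x| < r -> agree m x y.
  have [/xmin -> |/(agree_left dis m)[r r0 rP]] := pselect (ev_min x).
    exists 1 => // y ymin _.
    by rewrite (lexle_anti ymin (lexle_allmin y)) => i.
  exists r => // y yx; rewrite distrC ger0_norm ?subr_ge0 ?h_le//; exact: rP.
have [s s0 sP] : exists2 s, 0 < s &
    forall y, lexle x y -> `|F y - F x| < s -> agree m x y.
  have [/xmax -> |/(agree_right dis m)[s s0 sP]] := pselect (ev_max x).
    exists 1 => // y ymax _.
    by rewrite (lexle_anti ymax (lexle_allmax y)) => i.
  exists s => // y xy; rewrite ger0_norm ?subr_ge0 ?h_le//; exact: sP.
exists (Num.min r s); first by rewrite lt_min r0.
move=> y; rewrite lt_min => /andP[yr ys].
by have [xy|yx] := lexle_total x y; [exact: sP|exact: rP].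
Qed.

Lemma exceptional_eta k : (0 < k <= n)%N -> (F @` @exceptional n) (eta P k).
Proof.
case: k => // k /andP[_ kn]; exists (below (Ordinal kn) [::]).
  by exists (Ordinal kn), [::]; left.
rewrite (eta_max (P := P) (sym (Ordinal kn)) : eta P k.+1 = _).
by [].
Qed.

(** Off the images of exceptional pasts, a small neighbourhood in the unit    *)
(** interval lies in a single branch.                                         *)
Lemma near_branch w j : Omega w -> ~ (F @` @exceptional n) w ->
  branch_closure P j w -> exists2 r, 0 < r &
    forall v, Omega v -> v != w -> `|v - w| < r -> branch P j v.
Proof.
move=> Ow Nw; rewrite /branch_closure /= in_itv /= => /andP[jw wj].
have jj := eta_lt dis j.
have [wE|wj'] := eqVneq w (eta P j).
  have j0 : j = 0%N :> nat.
    apply/eqP/negPn/negP; rewrite -lt0n => j0; apply: Nw; rewrite wE.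
    by apply: exceptional_eta; rewrite j0 -ltnS /=.
  have w0 : w = 0 by rewrite wE j0 /eta eqxx.
  exists (eta P j.+1 - eta P j); first by rewrite subr_gt0.
  move=> v; rewrite /Omega /= in_itv /= => /andP[v0 _] vw.
  have {}v0 : 0 < v by rewrite lt_neqAle v0 -w0 eq_sym vw.
  rewrite ltr_norml /branch /= in_itv /= => /andP[_ vw'].
  by apply/andP; split; lra.
have [wE|wj''] := eqVneq w (eta P j.+1).
  have jn : j = n :> nat.
    apply/eqP/negPn/negP => jn; apply: Nw; rewrite wE; apply: exceptional_eta.
    by rewrite /= ltn_neqAle jn -ltnS /=.
  have w1 : w = 1 by rewrite wE jn /eta /= eqxx.
  exists (eta P j.+1 - eta P j); first by rewrite subr_gt0.
  move=> v; rewrite /Omega /= in_itv /= => /andP[_ v1] vw.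
  have {}v1 : v < 1 by rewrite lt_neqAle v1 -w1 vw.
  rewrite ltr_norml /branch /= in_itv /= => /andP[vw' _].
  by apply/andP; split; lra.
have : branch P j w.
  by rewrite /branch /= in_itv /= lt_neqAle jw eq_sym wj' lt_neqAle wj'' wj.
move=> bw; have [r /= r0 rP] : nbhs w (branch P j).
  by apply: open_nbhs_nbhs; split => //; exact: branch_open.
by exists r => // v _ _ vw; apply: rP; rewrite /= distrC.
Qed.

Lemma derivative_Omega T w : continuous_extension P T ->
  Omega w -> ~ (F @` @exceptional n) w ->
  deriv_within Omega T w (1 / p (hinv P w 0%N) (drop_last (hinv P w))).
Proof.
move=> cT Ow Nw; have wE := hinvK dis Ow.
set x := hinv P w in wE *; set j := x 0%N; set y := drop_last x.
have xE : x = push j y by rewrite push_eta.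
have Nx : ~ exceptional x by move=> Ex; apply: Nw; exists x.
have ymin : ev_min y -> y = @allmin n.
  move=> /(ev_min_push j y).2; rewrite -xE => /ev_minP[xm|[a [s xa]]].
    by rewrite /y xm.
  by case: Nx; exists a, s; right.
have ymax : ev_max y -> y = @allmax n.
  move=> /(ev_max_push j y).2; rewrite -xE => /ev_maxP[xm|[a [s xa]]].
    by rewrite /y xm.
  by case: Nx; exists a, s; left.
have jw : branch_closure P j w.
  by rewrite -wE xE /branch_closure /= in_itv /=; exact: (h_push_itv dis).
have [r r0 rP] := near_branch Ow Nw jw.
have Dj : deriv_within (branch_closure P j) (branch_map P j) w (1 / p j y).
  rewrite -wE xE; apply: (deriv_branch_agree dis unif) => // m.
  by have [s s0 sP] := agree_near m ymin ymax; exists s => // z _ zs _; exact: sP.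
apply: (deriv_within_transfer _ _ Dj).
  exists r => // v Ov vw vr; have jv := rP v Ov vw vr.
  by split; [exact: branch_sub_closure|exact: (extension_branch dis cT)].
rewrite (proj1 cT)// /T0 /= -/x -/y; by rewrite -wE xE (branch_mapE dis).
Qed.

(** ** Piecewise smoothness *)

Section Matching.
Hypothesis match_p : matching p.

(** Distinct pasts with the same image are consecutive, and the matching      *)
(** condition is the equality of p at consecutive pasts.                      *)
Lemma matching_h j x y : F x = F y -> p j x = p j y.
Proof.
move=> xy; have [->//|/(cdf_inj dis)/(_ xy)|/(cdf_inj dis)/(_ (esym xy))] := lexlt_total x y.
  by move=> [a [s [-> ->]]]; exact: match_p.
by move=> [a [s [-> ->]]]; apply/esym; exact: match_p.
Qed.

(** Continuity of p as a function on the unit interval: from the left one     *)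
(** uses the preimage that is not eventually minimal, from the right the one  *)
(** that is not eventually maximal.                                           *)
Lemma matching_continuous j x e : 0 < e -> exists2 r, 0 < r &
  forall y, `|F y - F x| < r -> `|p j y - p j x| <= e.
Proof.
move=> e0; have [m mP] := unif e0.
have [r r0 rP] : exists2 r, 0 < r &
    forall y, F y < F x -> `|F y - F x| < r -> `|p j y - p j x| <= e.
  suff [->|[z zx nz]] : x = @allmin n \/ exists2 z, F z = F x & ~ ev_min z.
  - exists 1 => // y; rewrite (h_allmin dis).
    by case/andP: (h_itv (P := P) y); lra.
  - have [r r0 rP] := agree_left dis m nz; exists r => // y.
    rewrite -(matching_h j zx) -zx => yz yr; rewrite distrC; apply/mP/rP.
      by right; exact: h_lt yz.
    by move: yr; rewrite distrC ger0_norm// subr_ge0 ltW.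
  have [/ev_minP[|[a [s xa]]]|] := pselect (ev_min x); [by left|right|right].
  - exists (below a s); last exact: (below_not_ev_min dis).
    by rewrite xa; exact: (below_above dis).
  - by exists x.
have [t t0 tP] : exists2 r, 0 < r &
    forall y, F x < F y -> `|F y - F x| < r -> `|p j y - p j x| <= e.
  suff [->|[z zx nz]] : x = @allmax n \/ exists2 z, F z = F x & ~ ev_max z.
  - exists 1 => // y; rewrite h_allmax.
    by case/andP: (h_itv (P := P) y); lra.
  - have [r' r0' rP'] := agree_right dis m nz; exists r' => // y.
    rewrite -(matching_h j zx) -zx => yz yr; rewrite distrC; apply/mP/rP'.
      by right; exact: h_lt yz.
    by move: yr; rewrite ger0_norm// subr_ge0 ltW.
  have [/ev_maxP[|[a [s xa]]]|] := pselect (ev_max x); [by left|right|right].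
  - exists (above a s); last exact: (above_not_ev_max dis).
    by rewrite xa; apply/esym; exact: (below_above dis).
  - by exists x.
exists (Num.min r t) => [|y]; first by rewrite lt_min r0.
rewrite lt_min => /andP[yr yt]; have [yx|yx|yx] := ltgtP (F y) (F x).
- exact: rP.
- exact: tP.
- by rewrite (matching_h j yx) subrr normr0 ltW.
Qed.

(** hinv picks one of at most two preimages, at which p takes the same value  *)
(** by the matching condition (branch_slopeE).                                *)
Definition branch_slope j w : R := 1 / p j (hinv P (branch_map P j w)).

Lemma branch_slopeE j x : branch_slope j (F (push j x)) = 1 / p j x.
Proof.
rewrite /branch_slope (branch_mapE dis); congr (1 / _); apply: matching_h.
by apply: (hinvK dis); exact: Omega_h.
Qed.

Lemma inv_p_dist j x y : `|1 / p j x - 1 / p j y| <= `|p j x - p j y| / d ^+ 2.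
Proof.
have px : 0 < p j x by exact: lt_le_trans (dp j x).
have py : 0 < p j y by exact: lt_le_trans (dp j y).
have -> : 1 / p j x - 1 / p j y = (p j y - p j x) / (p j x * p j y).
  by field; rewrite !gt_eqF.
rewrite normrM normfV distrC; apply: ler_wpM2l => //.
rewrite gtr0_norm ?mulr_gt0// lef_pV2 ?posrE ?exprn_gt0 ?mulr_gt0//.
by rewrite expr2; apply: ler_pM => //; exact: ltW.
Qed.

Lemma branch_C1 j : C1_on (eta P j) (eta P j.+1) (branch_map P j) (branch_slope j).
Proof.
split.
  move=> w jw; have [x ->] : exists x, w = F (push j x).
    by apply: (branch_closureP dis); rewrite /branch_closure /= in_itv.
  rewrite branch_slopeE; apply/deriv_withinP => e e0.
  have e0' : 0 < e * d ^+ 2 / 2 by rewrite divr_gt0// mulr_gt0// exprn_gt0.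
  have [r r0 rP] := matching_continuous j x e0'.
  exists (d * r) => [|v /(branch_closureP dis)[y ->] vx vr]; first by rewrite mulr_gt0.
  have yx : F y != F x by apply: contra vx => /eqP/(h_push_eq dis j) ->.
  have yr : `|F y - F x| < r.
    by rewrite -(ltr_pM2l d_gt0); apply: le_lt_trans (h_push_expand dis _ _ _) vr.
  have bnd u : between x y u -> `|p j u - p j x| <= e * d ^+ 2 / 2.
    move=> xyu; apply: rP; apply: le_lt_trans yr.
    case: xyu => -[/(h_le (P := P)) xu /(h_le (P := P)) uy].
      by rewrite !ger0_norm; lra.
    by rewrite distrC (distrC (F y)) !ger0_norm; lra.
  apply: le_lt_trans (diff_quotient_branch dis yx bnd) _.
  rewrite mulrAC mulfK ?expf_neq0 ?gt_eqF//.
  by rewrite ltr_pdivrMr//; lra.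
apply/within_continuousP => w /(branch_closureP dis)[x ->] e e0.
have e0' : 0 < e * d ^+ 2 / 2 by rewrite divr_gt0// mulr_gt0// exprn_gt0.
have [r r0 rP] := matching_continuous j x e0'.
exists (d * r) => [|v /(branch_closureP dis)[y ->] vr]; first by rewrite mulr_gt0.
rewrite !branch_slopeE; apply: le_lt_trans (inv_p_dist _ _ _) _.
have yr : `|F y - F x| < r.
  by rewrite -(ltr_pM2l d_gt0); apply: le_lt_trans (h_push_expand dis _ _ _) vr.
rewrite ltr_pdivrMr ?exprn_gt0//; apply: le_lt_trans (rP y yr) _.
by rewrite ltr_pdivrMr// ltr_pMr ?mulr_gt0 ?exprn_gt0// ltr1n.
Qed.

End Matching.
End Derivatives.

(** ** Hölder continuity *)

Section ContinuityRate.
Context {R : realType} {n : nat} {p : 'I_n.+1 -> past n -> R}.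
Hypothesis ptrans : transition_family p.

Lemma p_dist_le1 j x y : `|p j x - p j y| <= 1.
Proof.
case: ptrans => p01 _ _; have /andP[? ?] := p01 j x; have /andP[? ?] := p01 j y.
by rewrite ler_norml; lra.
Qed.

Lemma p_dist_rate m j x y : agree m x y -> `|p j x - p j y| <= continuity_rate p m.
Proof.
move=> xy; apply: ub_le_sup; last by exists j, x, y.
by exists 1 => _ [b [u [v [_ ->]]]]; exact: p_dist_le1.
Qed.

Lemma continuous_family_unif : continuous_family p -> forall e, 0 < e ->
  exists m, forall j x y, agree m x y -> `|p j x - p j y| <= e.
Proof.
move=> /cvgrPdist_lt pc e /pc[m _ /(_ m (leqnn m))]; rewrite sub0r normrN => me.
exists m => j x y /p_dist_rate/le_trans; apply; exact: le_trans (ler_norm _) (ltW me).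
Qed.

End ContinuityRate.

(** alpha is log rho / log d, capped at 1.                                    *)
Lemma holder_exponent (R : realType) (d rho : R) : 0 < d < 1 -> 0 < rho < 1 ->
  exists2 alpha, 0 < alpha <= 1 & rho <= d `^ alpha.
Proof.
move=> /andP[d0 d1] /andP[r0 r1].
have ld : ln d < 0 by rewrite ln_lt0// d0.
have lr : ln rho < 0 by rewrite ln_lt0// r0.
exists (Num.min 1 (ln rho / ln d)).
  rewrite lt_min ltr01 ge_min lexx /= andbT.
  by rewrite -mulrNN -invrN divr_gt0// oppr_gt0.
rewrite /powR gt_eqF// -[leLHS](lnK r0) ler_expR.
by rewrite -ler_ndivlMr// ge_min lexx orbT.
Qed.

Section Holder.
Context {R : realType} {n : nat} {P : probability (words int n) R}.
Context {p : 'I_n.+1 -> past n -> R} {d : R}.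
Hypothesis dis : disintegrated (past_law P) p d.
Hypothesis match_p : matching p.
Variables (alpha rho B : R).
Hypotheses (alpha_gt0 : 0 < alpha) (rho_ge0 : 0 <= rho)
  (rho_le : rho <= d `^ alpha) (B_ge0 : 0 <= B).
Hypothesis rate : forall m j x y, agree m x y -> `|p j x - p j y| <= B * rho ^+ m.
Notation F := (h P).
Implicit Types (x y : past n) (j : 'I_n.+1) (v w : R).

Let d_gt0 : 0 < d. Proof. by case: dis. Qed.
Let K := B * (d `^ alpha)^-1.

Let K_ge0 : 0 <= K.
Proof. by rewrite mulr_ge0// invr_ge0 powR_ge0. Qed.

Let powRXl m : (d ^+ m) `^ alpha = (d `^ alpha) ^+ m.
Proof.
rewrite -powR_mulrn ?(ltW d_gt0)// -powRrM mulrC powRrM powR_mulrn//.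
exact: powR_ge0.
Qed.

(** If a cylinder of length m + 1 lies between x and y then t, the length of  *)
(** the image, is at least d ^+ m.+1, and rho ^+ m is at most the power of    *)
(** exponent alpha of d ^+ m. The missing factor d is absorbed in K.          *)
Let holder_gap j m x y (t : R) : agree m x y -> d ^+ m.+1 <= t ->
  `|p j x - p j y| <= K * t `^ alpha.
Proof.
move=> xy dt; apply: (le_trans (rate j xy)).
have a0 : 0 < d `^ alpha by exact: powR_gt0.
apply: (@le_trans _ _ (B * (d `^ alpha) ^+ m)).
  by apply: ler_wpM2l => //; apply: lerXn2r; rewrite ?nnegrE// ltW.
apply: (@le_trans _ _ (K * (d ^+ m.+1) `^ alpha)).
  by rewrite powRXl exprS /K mulrA mulfVK// gt_eqF.
apply: ler_wpM2l => //; apply: ge0_ler_powR => //; rewrite ?nnegrE ?ltW//.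
  by rewrite exprn_gt0.
by apply: lt_le_trans dt; rewrite exprn_gt0.
Qed.

(** Let k be the first place from m on where x is not maximal: the cylinder   *)
(** of length k + 1 that starts like x and has the maximal symbol at k lies   *)
(** between x and cylmax m x, which agree up to k.                            *)
Let holder_cylmax j m x :
  `|p j x - p j (cylmax m x)| <= K * (F (cylmax m x) - F x) `^ alpha.
Proof.
have xx : agree m x (cylmax m x) by exact: agree_cylmax.
have [<-|[k [kE kl]]] := le_cylmax (fun i (_ : (i < m)%N) => erefl (x i)).
  by rewrite subrr normr0 mulr_ge0// powR_ge0.
apply: (holder_gap _ kE).
have mk : (m <= k)%N.
  by rewrite leqNgt; apply/negP => km; move: kl; rewrite -xx// ltnn.
apply: (cdf_gap dis (z := fun i => if i == k then cylmax m x k else x i)) => u zu.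
have ux i : (i < k)%N -> u i = x i.
  by move=> ik; rewrite -zu ?(ltn_eqF ik)// ltnS ltnW.
split.
  right; exists k; split=> [i /ux -> //|].
  by rewrite -zu// eqxx.
apply: le_cylmax => i im; rewrite ux//; exact: leq_trans mk.
Qed.

Let holder_cylmin j m x :
  `|p j (cylmin m x) - p j x| <= K * (F x - F (cylmin m x)) `^ alpha.
Proof.
have xx : agree m x (cylmin m x) by exact: agree_cylmin.
have [->|[k [kE kl]]] := cylmin_le (fun i (_ : (i < m)%N) => erefl (x i)).
  by rewrite subrr normr0 mulr_ge0// powR_ge0.
apply: (holder_gap _ kE).
have mk : (m <= k)%N.
  by rewrite leqNgt; apply/negP => km; move: kl; rewrite -xx// ltnn.
apply: (cdf_gap dis (z := fun i => if i == k then cylmin m x k else x i)) => u zu.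
have ux i : (i < k)%N -> u i = x i.
  by move=> ik; rewrite -zu ?(ltn_eqF ik)// ltnS ltnW.
split.
  apply: (@cylmin_le _ m x u) => i im; rewrite ux//; exact: leq_trans mk.
right; exists k; split=> [i /ux -> //|].
by rewrite -zu// eqxx.
Qed.

(** At the first place m where x and y differ, either a symbol is skipped and *)
(** a cylinder of length m + 1 lies between, or the path from x to y goes     *)
(** through the consecutive pasts cylmax m.+1 x and cylmin m.+1 y, at which p *)
(** takes the same value.                                                     *)
Let holder_p_lt j x y : lexlt x y ->
  `|p j x - p j y| <= (K + K) * (F y - F x) `^ alpha.
Proof.
move=> xy; have mono s t : 0 <= s <= t -> K * s `^ alpha <= K * t `^ alpha.
  move=> /andP[s0 st]; apply: ler_wpM2l => //.
  apply: ge0_ler_powR => //; first exact: ltW.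
  by rewrite nnegrE (le_trans s0).
have Fxy : F x <= F y by apply: h_le; right.
case: (xy) => m [mE ml].
have [xym|xym] := ltnP (x m).+1 (y m).
  have xn : ((x m).+1 < n.+1)%N by apply: (ltn_trans xym).
  apply: (@le_trans _ _ (K * (F y - F x) `^ alpha)); last first.
    by rewrite mulrDl lerDl mulr_ge0// powR_ge0.
  apply: (holder_gap _ mE).
  apply: (cdf_gap dis (z := fun i => if i == m then Ordinal xn else x i)) => u zu.
  have ux i : (i < m)%N -> u i = x i.
    by move=> im; rewrite -zu ?(ltn_eqF im)// ltnS ltnW.
  by split; right; exists m; (split=> [i im|]; [rewrite ux// mE|rewrite -zu// eqxx]).
have xn : (x m < n)%N by apply: (leq_trans ml); rewrite -ltnS.
have E : y m = (x m).+1 :> nat by apply/eqP; rewrite eqn_leq xym ml.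
pose a := Ordinal xn; pose s := mkseq x m.
have pushE c z i : pushs (rcons s c) z i =
    if (i < m)%N then x i else if i == m then c else z (i - m.+1)%N.
  rewrite pushsE size_rcons size_mkseq nth_rcons size_mkseq ltnS.
  by case: ltngtP => // im; rewrite nth_mkseq.
have bE : below a s = cylmax m.+1 x.
  apply/funext => i; rewrite /below pushE /cylmax ltnS.
  by case: ltngtP => // ->; apply: val_inj.
have aE : above a s = cylmin m.+1 y.
  apply/funext => i; rewrite /above pushE /cylmin ltnS.
  case: ltngtP => // [/mE //|->].
  by apply: val_inj; rewrite /= /bump add1n E.
have pba : p j (cylmax m.+1 x) = p j (cylmin m.+1 y) by rewrite -bE -aE match_p.
have Fba : F (cylmax m.+1 x) = F (cylmin m.+1 y).
  by rewrite -bE -aE; exact: (below_above dis).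
have xb : F x <= F (cylmax m.+1 x) by apply: h_le; exact: le_cylmax.
have ay : F (cylmin m.+1 y) <= F y by apply: h_le; exact: cylmin_le.
have -> : p j x - p j y =
    (p j x - p j (cylmax m.+1 x)) + (p j (cylmin m.+1 y) - p j y).
  by rewrite pba; ring.
apply: (le_trans (ler_normD _ _)); rewrite mulrDl; apply: lerD.
  by apply: (le_trans (holder_cylmax j m.+1 x)); apply: mono; lra.
by apply: (le_trans (holder_cylmin j m.+1 y)); apply: mono; lra.
Qed.

Lemma holder_p j x y : `|p j x - p j y| <= (K + K) * `|F x - F y| `^ alpha.
Proof.
have [->|xy|yx] := lexlt_total x y.
- by rewrite subrr normr0 mulr_ge0// ?powR_ge0// addr_ge0.
- rewrite [`|F x - F y|]distrC [`|F y - F x|]ger0_norm; first exact: holder_p_lt.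
  by rewrite subr_ge0; apply: h_le; right.
- rewrite distrC [`|F x - F y|]ger0_norm; first exact: holder_p_lt.
  by rewrite subr_ge0; apply: h_le; right.
Qed.

Lemma branch_holder j :
  holder_on (eta P j) (eta P j.+1) alpha (branch_slope (P := P) (p := p) j).
Proof.
exists ((K + K) * d^-1 `^ alpha / d ^+ 2) => v w jv jw.
have [x vE] : exists x, v = F (push j x).
  by apply: (branch_closureP dis); rewrite /branch_closure /= in_itv.
have [y wE] : exists y, w = F (push j y).
  by apply: (branch_closureP dis); rewrite /branch_closure /= in_itv.
rewrite {}vE {}wE !(branch_slopeE dis match_p).
apply: (le_trans (inv_p_dist dis _ _ _)); rewrite mulrAC; apply: ler_wpM2r.
  by rewrite invr_ge0 exprn_ge0// ltW.
apply: (le_trans (holder_p _ _ _)); rewrite -mulrA; apply: ler_wpM2l.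
  by rewrite addr_ge0.
rewrite -powRM ?invr_ge0 ?(ltW d_gt0)//; apply: ge0_ler_powR.
- exact: ltW.
- by rewrite nnegrE.
- by rewrite nnegrE mulr_ge0// invr_ge0 ltW.
- rewrite ler_pdivlMl// distrC (distrC (F (push j x))).
  exact: (h_push_expand dis).
Qed.

End Holder.

(** * The interval map and the shift *)

Lemma measure_eq_mod d (T : measurableType d) (R : realType)
    (m : {measure set T -> \bar R}) (A B N : set T) :
  measurable A -> measurable B -> m.-negligible N ->
  (forall x, ~ N x -> A x <-> B x) -> m A = m B.
Proof.
move=> mA mB [N' [mN' N'0 NN']] AB.
wlog suff : A B mA mB AB / (m A <= m B)%E => [wl|].
  apply/eqP; rewrite eq_le (wl A B)// (wl B A)// => x Nx.
  exact: iff_sym (AB x Nx).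
apply: (@le_trans _ _ (m (B `|` N'))); last first.
  by rewrite -[leRHS]adde0 -N'0; exact: measureU2.
apply: le_measure; rewrite ?inE//; first exact: measurableU.
move=> x Ax; have [/NN'|Nx] := pselect (N x); [by right|left].
exact: (AB x Nx).1.
Qed.

(** An invariant event modulo a null set differs by a null set from the       *)
(** strictly invariant event that it occurs infinitely often along the shift. *)
Lemma ergodic_mod_null (R : realType) (n : nat) (P : probability (words int n) R)
    (A : set (words int n)) :
  stationary P -> shift_ergodic P -> measurable A ->
  P ((@word_shift n @^-1` A) `+` A) = 0%E -> P A = 0%E \/ P A = 1%E.
Proof.
move=> sP eP mA AS0.
pose S := @word_shift n; pose D := (S @^-1` A) `+` A.
have mS B : measurable B -> measurable (S @^-1` B).
  by move=> mB; rewrite -[X in measurable X]setTI; exact: measurable_word_shift.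
have mD : measurable D by apply: measurableU; apply: measurableD => //; exact: mS.
have miter k B : measurable B -> measurable (iter k S @^-1` B).
  elim: k B => [//|k IH] B mB.
  by rewrite (_ : _ @^-1` _ = iter k S @^-1` (S @^-1` B))//; exact: IH (mS _ mB).
have Piter k B : measurable B -> P (iter k S @^-1` B) = P B.
  elim: k B => [//|k IH] B mB.
  rewrite (_ : _ @^-1` _ = iter k S @^-1` (S @^-1` B))// IH; last exact: mS.
  exact: sP.
pose N := \bigcup_k (iter k S @^-1` D).
have N0 : P.-negligible N.
  apply: negligible_bigcup => k; apply/negligibleP; first exact: miter.
  by rewrite -AS0; exact: Piter.
pose L := \bigcap_k \bigcup_(l in [set l | (k <= l)%N]) (iter l S @^-1` A).
have mL : measurable L.
  by apply: bigcapT_measurable => k; apply: bigcup_measurable => l _; exact: miter.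
have SL : S @^-1` L = L.
  apply/seteqP; split=> z zL k _.
    by have [l kl zl] := zL k I; exists l.+1; [exact: leqW|rewrite /= -iterS iterSr].
  have [[//|l] kl zl] := zL k.+1 I; exists l => //.
  by move: zl; rewrite /= -iterS iterSr.
have stepN z : ~ N z -> forall k, A (iter k S z) <-> A z.
  move=> Nz; elim=> [//|k IH]; rewrite -IH.
  have nD : ~ D (iter k S z) by move=> zD; apply: Nz; exists k.
  split=> [Az|Az]; apply: contrapT => nA; apply: nD; [left|right]; split => //.
have -> : P A = P L.
  apply: (measure_eq_mod mA mL N0) => z /stepN zA; split=> [Az k _|/(_ 0%N I)[l _ Al]].
    by exists k; [exact: leqnn|exact: ((zA k).2 Az)].
  exact: ((zA l).1 Al).
exact: eP.
Qed.

Lemma closure_itvoo (R : realType) (a b : R) : a < b -> closure `]a, b[ = `[a, b]%classic.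
Proof.
move=> ab; pose c := (a + b) / 2; pose r := (b - a) / 2.
have r0 : 0 < r by rewrite divr_gt0// subr_gt0.
have ca : c - r = a by rewrite /c /r; lra.
have cb : c + r = b by rewrite /c /r; lra.
have -> : `]a, b[%classic = ball c r by rewrite ball_itv ca cb.
by rewrite -[LHS]/(closed_ball c r) closed_ball_itv// ca cb.
Qed.

Section Dynamics.
Context {R : realType} {n : nat} {P : probability (words int n) R}.
Context {p : 'I_n.+1 -> past n -> R} {d : R}.
Hypothesis dis : disintegrated (past_law P) p d.
Variable T : R -> R.
Hypothesis cT : continuous_extension P T.
Notation F := (h P).
Notation mu := (past_law P).
Implicit Types (x y : past n) (j : 'I_n.+1) (v w : R).

Lemma extension_increasing j : {in branch P j &, {homo T : v w / v < w}}.
Proof.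
move=> v w; rewrite !inE => jv jw.
have [x vE x01] := branchP dis jv; have [y wE y01] := branchP dis jw.
rewrite vE wE (h_push_lt dis) => xy.
by rewrite !(extension_h_push dis).
Qed.

Lemma extension_image j : T @` branch P j = `]0, 1[%classic.
Proof.
apply/seteqP; split=> [_ [w /(branchP dis)[x -> x01] <-]|t].
  by rewrite (extension_h_push dis)//= in_itv.
rewrite /= in_itv /= => t01.
have [x xt] : exists x, F x = t by apply: (h_onto dis); case/andP: t01 => ? ?; rewrite !ltW.
exists (F (push j x)); first by apply: (branch_h_push dis); rewrite xt.
by rewrite (extension_h_push dis)// xt.
Qed.

Lemma extension_Omega w : branches P w -> Omega (T w).
Proof.
move=> [j _ jw]; rewrite (extension_branch dis cT jw).
by have [x -> _] := branchP dis jw; rewrite (branch_mapE dis); exact: Omega_h.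
Qed.

Lemma bigcup_branch_closure : \bigcup_j branch_closure P j = Omega.
Proof.
apply/seteqP; split=> w.
  by move=> [j _ /(branch_closureP dis)[x ->]]; exact: Omega_h.
rewrite /Omega /= in_itv /= => /(h_onto dis)[x <-]; exists (x 0%N) => //.
by rewrite -{2}(push_eta x) /branch_closure /= in_itv /=; exact: (h_push_itv dis).
Qed.

(** Every branch is full: the open interval is mapped onto (0, 1).            *)
Lemma extension_markov : topological_markov (branch P) T.
Proof.
split=> [j w jw|j|i].
- by apply: extension_Omega; exists j.
- left=> v w jv jw; rewrite le_eqVlt => /orP[/eqP -> //|vw].
  exact/ltW/(extension_increasing jv jw).
- exists (finset.setTfor 'I_n.+1); rewrite extension_image closure_itvoo ?ltr01//.
  rewrite -[LHS]bigcup_branch_closure; apply/seteqP; split=> w [j _ jw].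
    by exists j; rewrite /= ?finset.in_setT// closure_itvoo//; exact: (eta_lt dis).
  by exists j => //; move: jw; rewrite closure_itvoo//; exact: (eta_lt dis).
Qed.

(** ** The conjugacy off the eventually constant pasts *)

Lemma negligible_ev_extreme : mu.-negligible (@ev_extreme n).
Proof.
have cE := @countable_ev_extreme n; have mE := measurable_countable cE.
apply/negligibleP => //; apply: etrans (massE mu mE) _.
by rewrite (mass_countable dis cE).
Qed.

Lemma ev_extreme_drop_last x : ~ ev_extreme x -> ~ ev_extreme (drop_last x).
Proof.
move=> nx ex; apply: nx; rewrite -(push_eta x).
by case: ex; [left; apply/ev_min_push|right; apply/ev_max_push].
Qed.

Lemma branch_h x : ~ ev_extreme x -> branch P (x 0%N) (F x).
Proof.
move=> /ev_extreme_drop_last nx; rewrite -{2}(push_eta x).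
apply: (branch_h_push dis); rewrite (h_gt0 dis) ?(h_lt1 dis)// => ex; apply: nx.
  by right.
by left.
Qed.

(** The conjugacy of T with the shift: an eventually constant past could be   *)
(** mapped to an end point, where T is arbitrary.                             *)
Lemma extension_h x : ~ ev_extreme x -> T (F x) = F (drop_last x).
Proof.
move=> nx; rewrite -{1}(push_eta x); apply: (extension_h_push dis _ cT).
have {}nx := ev_extreme_drop_last nx.
by rewrite (h_gt0 dis) ?(h_lt1 dis)// => ex; apply: nx; [right|left].
Qed.

Lemma itinerary_h k x : ~ ev_extreme x -> itinerary P T k (F x) = x k.
Proof.
elim: k x => [|k IH] x nx.
  rewrite /itinerary /=; case: xgetP => [j _ /(branch_first dis) -> //|/(_ (x 0%N))[]].
  exact: (branch_h nx).
rewrite /itinerary iterSr extension_h// -[RHS]/(drop_last x k) -IH//.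
exact: ev_extreme_drop_last.
Qed.

Lemma measurable_branch j : measurable (branch P j).
Proof. exact: measurable_itv. Qed.

Lemma measurable_branches : measurable (branches P).
Proof. by apply: fin_bigcup_measurable => // j _; exact: measurable_branch. Qed.

Lemma measurable_h : measurable_fun setT (F : past n -> R).
Proof. exact: (measurable_cdf dis). Qed.

Lemma measurable_h_preimage (B : set R) : measurable B -> measurable (F @^-1` B).
Proof. by move=> mB; rewrite -[X in measurable X]setTI; exact: measurable_h. Qed.

Lemma lebesgue_h (B : set R) : measurable B -> B `<=` Omega ->
  lebesgue_measure B = mu (F @^-1` B).
Proof. by move=> mB BO; rewrite (cdf_law dis mB) setIidl. Qed.

Lemma measurable_extension_preimage (B : set R) : measurable B ->
  measurable (branches P `&` T @^-1` B).
Proof.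
move=> mB; rewrite (_ : _ `&` _ = \bigcup_j (branch P j `&` T @^-1` B)).
  apply: fin_bigcup_measurable => // j _.
  have := @subspace_continuous_measurable_fun R (branch P j) T.
  by apply => //; [exact: measurable_branch|exact: (proj2 cT)|exact: measurable_branch].
apply/seteqP; split=> w; first by move=> [[j _ jw] Bw]; exists j.
by move=> [j _ [jw Bw]]; split=> //; exists j.
Qed.

Lemma h_preimage_extension x (B : set R) : ~ ev_extreme x ->
  (F @^-1` (branches P `&` T @^-1` B)) x <-> (@drop_last n @^-1` (F @^-1` B)) x.
Proof.
move=> nx; rewrite /preimage /= extension_h//; split=> [[]//|Bx]; split=> //.
by exists (x 0%N) => //; exact: branch_h.
Qed.

Lemma measurable_drop_preimage (C : set (past n)) : measurable C ->
  measurable (@drop_last n @^-1` C).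
Proof. by move=> mC; rewrite -[X in measurable X]setTI; exact: measurable_drop_last. Qed.

Lemma extension_invariant : stationary P -> lebesgue_invariant (branches P) T.
Proof.
move=> sP B mB BO; have mTB := measurable_extension_preimage mB; split=> //.
have mFB := measurable_h_preimage mB.
rewrite (lebesgue_h mB BO) (lebesgue_h mTB); last first.
  by move=> w [[j _ /(branch_Omega dis)]].
rewrite -(past_law_drop_last sP mFB).
apply: (measure_eq_mod (measurable_h_preimage mTB)
  (measurable_drop_preimage mFB) negligible_ev_extreme).
by move=> x; exact: h_preimage_extension.
Qed.

Lemma extension_ergodic : stationary P -> shift_ergodic P ->
  lebesgue_ergodic (branches P) T.
Proof.
move=> sP eP B mB BO; have mTB := measurable_extension_preimage mB.
have mD : measurable ((branches P `&` T @^-1` B) `+` B).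
  by apply: measurableU; exact: measurableD.
rewrite (lebesgue_h mB BO) lebesgue_h//; last first.
  by move=> w [[[[j _ /(branch_Omega dis)]]]|[/BO]].
move=> D0; pose A := @past0 n @^-1` (F @^-1` B).
have mA : measurable A.
  rewrite -[X in measurable X]setTI; apply: measurable_past0 => //.
  exact: measurable_h_preimage.
apply: (@ergodic_mod_null _ _ P A) => //; rewrite -D0.
have shiftE : @word_shift n @^-1` A = @past0 n @^-1` (@drop_last n @^-1` (F @^-1` B)).
  by apply/seteqP; split=> z; rewrite /A /preimage /mkset past0_shift.
rewrite shiftE -[LHS]/(mu ((@drop_last n @^-1` (F @^-1` B)) `+` (F @^-1` B))).
have mFB := measurable_h_preimage mB.
apply: (measure_eq_mod _ (measurable_h_preimage mD) negligible_ev_extreme).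
  by apply: measurableU; apply: measurableD => //; exact: measurable_drop_preimage.
move=> x /(@h_preimage_extension _ B) E.
rewrite /setY /setU /setD /=; move: E; rewrite /preimage /= => E.
tauto.
Qed.

End Dynamics.

(** ** Conditional probabilities along the itinerary *)

Section Itineraries.
Context {R : realType} {n : nat} {P : probability (words int n) R}.
Context {p : 'I_n.+1 -> past n -> R} {d : R}.
Hypothesis dis : disintegrated (past_law P) p d.
Variable T : R -> R.
Hypothesis cT : continuous_extension P T.
Notation F := (h P).
Notation mu := (past_law P).
Implicit Types (x y : past n) (j : 'I_n.+1) (v w : R).

Let dp a x : d <= p a x. Proof. by case: dis. Qed.
Let d_gt0 : 0 < d. Proof. by case: dis. Qed.
Let mp a : measurable_fun setT (p a).
Proof. by case: dis => _ _ _ _ /(_ a setT measurableT)[]. Qed.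
Let p_ge0 a x : 0 <= p a x. Proof. exact: le_trans (ltW d_gt0) (dp a x). Qed.

Definition future w : past n := fun i => itinerary P T i.+1 w.

Lemma future_h x : ~ ev_extreme x -> future (F x) = drop_last x.
Proof. by move=> nx; apply/funext => i; exact: (itinerary_h dis cT). Qed.

Let mOmega : measurable (@Omega R). Proof. exact: measurable_itv. Qed.

Let countable_endpoints : countable (Omega `\` branches P).
Proof.
apply: (@sub_countable _ _ _ (F @` @ev_extreme n)); last first.
  exact: sub_countable (card_image_le _ _) countable_ev_extreme.
apply: subset_card_le => w [].
rewrite {1}/Omega /= in_itv /= => /(h_onto dis)[x <-] nb.
exists x => //; apply: contrapT => nx; apply: nb; exists (x 0%N) => //.
exact: (branch_h dis).
Qed.

Let measurable_endpoints (A : set R) : measurable (A `&` (Omega `\` branches P)).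
Proof.
apply: countable_measurable => [t|]; first exact: measurable_set1.
apply: sub_countable countable_endpoints.
by apply: subset_card_le => w [].
Qed.

(** The value of the itinerary at the countably many points outside the       *)
(** branches is uncontrolled but does not affect measurability; elsewhere the *)
(** itinerary at time k + 1 is the itinerary at time k of the image by T.     *)
Lemma measurable_itinerary k a :
  measurable (Omega `&` [set w | itinerary P T k w = a]).
Proof.
pose E k := Omega `&` [set w | itinerary P T k w = a].
have bO w : branches P w -> Omega w by move=> [j _ /(branch_Omega dis)].
have split_E l B : (forall w, branches P w -> E l w <-> B w) -> measurable (branches P `&` B) ->
    measurable (E l).
  move=> EB mB; rewrite (_ : E l = (branches P `&` B) `|`
      ([set w | itinerary P T l w = a] `&` (Omega `\` branches P))).
    exact: measurableU.
  apply/seteqP; split=> w.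
    move=> Ew; have [bw|nb] := pselect (branches P w); [left|right].
      by split=> //; apply/EB.
    by case: Ew.
  by move=> [[bw /EB]|[wa [Ow _]]]; [apply|split].
elim: k => [|k IH].
  apply: (split_E 0%N (branch P a)) => [w bw|].
    split=> [[_ <-]|aw].
      case: bw => j _ jw; rewrite /itinerary /=.
      by case: xgetP => [//|/(_ j)]; case.
    split; first exact: bO.
    rewrite /= /itinerary /=; case: xgetP => [j _ jw|/(_ a)/(_ aw)//].
    have [x wE _] := branchP dis aw; rewrite wE in jw.
    by rewrite -(branch_first dis jw).
  by apply: measurableI; [exact: (measurable_branches (P := P))|exact: measurable_branch].
apply: (split_E k.+1 (T @^-1` E k)) => [w bw|].
  rewrite /E /preimage /= /itinerary iterSr; split=> [[_ wa]|[_ wa]]; split => //.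
    exact: (extension_Omega dis cT).
  exact: bO.
exact: (measurable_extension_preimage cT).
Qed.

Lemma future_algebra_measurable : future_algebra P T `<=` measurable.
Proof.
apply: smallest_sub.
  split; [exact: measurable0|move=> A mA; exact: measurableD|].
  by move=> A mA; exact: bigcupT_measurable.
by move=> _ [k [a ->]]; exact: measurable_itinerary.
Qed.

Lemma future_preimage (C : set (past n)) : measurable C ->
  future_algebra P T (Omega `&` future @^-1` C).
Proof.
have [G0 GD GU] := smallest_sigma_algebra (@Omega R)
  [set B | exists k a, B = Omega `&` [set w | itinerary P T k.+1 w = a]].
apply: (@smallest_sub _ (sigma_algebra setT) (@coord_sets nat n)
  [set C : set (past n) | future_algebra P T (Omega `&` future @^-1` C)]).
  split=> /=.
  - by rewrite preimage_set0 setI0.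
  - move=> A /GD; congr (future_algebra P T _); apply/seteqP; split=> w /=.
      by move=> [Ow nA]; split=> //; split=> // Aw; apply: nA.
    by move=> [Ow [_ nA]]; split=> // -[_ Aw]; apply: nA.
  - by move=> A /GU; rewrite preimage_bigcup setI_bigcupr.
move=> _ [i [a ->]] /=; apply: sub_sigma_algebra; exists i, a.
by [].
Qed.

Lemma future_algebraP (B : set R) : future_algebra P T B ->
  exists2 C : set (past n), measurable C & B = Omega `&` future @^-1` C.
Proof.
apply: (@smallest_sub _ (sigma_algebra Omega) _
  [set B | exists2 C : set (past n), measurable C & B = Omega `&` future @^-1` C]).
  split=> /=.
  - by exists set0 => //; rewrite preimage_set0 setI0.
  - move=> _ [C mC ->]; exists (~` C); first exact: measurableC.
    apply/seteqP; split=> w /=; first by move=> [Ow nC]; split=> // Cw; apply: nC.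
    by move=> [Ow nC]; split=> // -[_ Cw]; apply: nC.
  - move=> A /(_ _)/cid2-/all_sig[C CP]; exists (\bigcup_k C k).
      by apply: bigcupT_measurable => k; case: (CP k).
    rewrite preimage_bigcup setI_bigcupr; apply: eq_bigcupr => k _.
    by case: (CP k).
move=> _ [k [a ->]]; exists [set x : past n | x k = a] => //.
exact: measurable_coord.
Qed.

Let h_mixin :=
  isMeasurableFun.Build _ _ (past n) (measurableTypeR R) F (measurable_h dis).
Let h_rv : {mfun past n >-> measurableTypeR R} :=
  HB.pack (F : past n -> measurableTypeR R) h_mixin.
Let nu : {measure set (measurableTypeR R) -> \bar R} := distribution mu h_rv.

(** An event B of the future algebra is the preimage of a set C of pasts. By  *)
(** the conjugacy and stationarity the integral over B becomes the integral   *)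
(** of p(b | .) over C with respect to mu, which is the mass of the pasts     *)
(** with last symbol b and remainder in C.                                    *)
Lemma conditional_prob_future b : stationary P ->
  conditional_prob_version [set w | itinerary P T 0 w = b]
    (future_algebra P T) (fun w => p b (future w)).
Proof.
move=> sP; split; first exact: future_algebra_measurable.
  move=> Y mY; rewrite (_ : _ @^-1` Y = future @^-1` (p b @^-1` Y))//.
  by apply: future_preimage; rewrite -[X in measurable X]setTI; exact: mp.
move=> B GB; have mB := future_algebra_measurable GB.
have [C mC BE] := future_algebraP GB.
have BO : B `<=` Omega by rewrite BE => w [].
have mFB := measurable_h_preimage dis mB.
have mq : measurable_fun B (EFin \o (fun w => p b (future w))).
  apply/measurable_EFinP; apply: (measurable_funS mOmega BO) => _ Y mY.
  apply: future_algebra_measurable.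
  rewrite (_ : _ @^-1` Y = future @^-1` (p b @^-1` Y))//.
  by apply: future_preimage; rewrite -[X in measurable X]setTI; exact: mp.
have mBE : measurable (B `&` [set w | itinerary P T 0 w = b]).
  rewrite (_ : _ `&` _ = B `&` (Omega `&` [set w | itinerary P T 0 w = b])).
    by apply: measurableI => //; exact: measurable_itinerary.
  by rewrite setIA (setIidl BO).
have BC x : ~ ev_extreme x -> B (F x) <-> C (drop_last x).
  move=> nx; rewrite BE /setI /preimage /= (future_h nx); split=> [[]//|Cx].
  by split=> //; exact: Omega_h.
have -> : lebesgue_measure (B `&` [set w | itinerary P T 0 w = b]) =
    (\int[mu]_(x in C) (p b x)%:E)%E.
  have <- : mu (push_set b C) = (\int[mu]_(x in C) (p b x)%:E)%E.
    by case: dis => _ _ _ _ /(_ b C mC)[].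
  rewrite (lebesgue_h dis mBE); last by move=> w [/BO].
  apply: (measure_eq_mod _ _ (negligible_ev_extreme dis)).
  - exact: (measurable_h_preimage dis).
  - exact: measurable_push_set.
  - move=> x nx; rewrite /preimage /setI /push_set /= (itinerary_h dis cT)//.
    by split=> [[/(BC _ nx) ? ?]|[? /(BC _ nx)]].
pose q w := (p b (future w))%:E.
have step1 : (\int[lebesgue_measure]_(w in B) q w =
              \int[nu]_(w in B) q w)%E.
  by apply: (eq_measure_integral nu) => A mA AB; apply: (lebesgue_h dis mA) => w /AB/BO.
have step2 : (\int[nu]_(w in B) q w = \int[mu]_(x in F @^-1` B) (q \o F) x)%E.
  have q0 : {in B, forall w, (0 <= q w)%E} by move=> w _; rewrite lee_fin.
  refine (@ge0_integral_pushforward _ _ (past n) (measurableTypeR R) R h_rv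
    (measurable_h dis) mu B q mB mq q0).
rewrite step1 step2.
transitivity (\int[mu]_(x in @drop_last n @^-1` C) ((EFin \o p b) \o @drop_last n) x)%E.
  have mdC := measurable_drop_preimage mC.
  rewrite integral_mkcond [RHS]integral_mkcond; apply: ge0_ae_eq_integral => //.
  - apply/(measurable_restrictT _ _).1 => //.
    apply: (measurable_comp mB) mq _ => [_ [x Bx <-]//|].
    exact: measurable_funS (measurable_h dis).
  - apply/(measurable_restrictT _ _).1 => //.
    apply/measurable_EFinP; apply: measurable_funS measurableT _ _ => //.
    exact: measurableT_comp (mp b) (@measurable_drop_last n).
  - by move=> x _; apply: erestrict_ge0 => y _; rewrite lee_fin.
  - by move=> x _; apply: erestrict_ge0 => y _; rewrite lee_fin.
  have [N [mN N0 subN]] := negligible_ev_extreme dis.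
  exists N; split=> // x nE; apply: subN; apply: contrapT => nx; apply: nE => _.
  rewrite /patch /q /= (future_h nx).
  have -> // : (x \in F @^-1` B) = (x \in @drop_last n @^-1` C).
  by apply/idP/idP; rewrite !inE => /(BC x nx).
rewrite -(ge0_integral_pushforward (@measurable_drop_last n) mu) //.
- by apply: eq_measure_integral => A mA _; exact: past_law_drop_last.
- by apply/measurable_EFinP; exact: measurable_funS (mp b).
- by move=> x _; rewrite lee_fin.
Qed.

End Itineraries.

(** * The main theorem *)

(** Over a single symbol there is only one sequence.                          *)
Lemma atomless_alphabet (R : realType) (n : nat)
    (P : probability (words int n) R) : atomless P -> (0 < n)%N.
Proof.
case: n P => // P /(_ (fun=> ord0)) P0; have := probability_setT P.
rewrite (_ : setT = [set (fun=> ord0) : words int 0]).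
  by rewrite P0 => /esym/eqP; rewrite onee_eq0.
by apply/seteqP; split=> // z _; apply/funext => i; rewrite [z i]ord1.
Qed.

Lemma disintegrated_past_law (R : realType) (n : nat)
    (p : 'I_n.+1 -> past n -> R) (P : probability (words int n) R) :
  transition_family p -> non_null p -> stationary P -> atomless P ->
  invariant_wrt P p ->
  disintegrated (past_law P) p (inf [set r : R | exists a x, r = p a x]).
Proof.
move=> ptrans pn sP aP Pp; have [p01 sum_p mp] := ptrans.
split=> //; first exact: atomless_alphabet aP.
- move=> a x; apply: ge_inf; last by exists a, x.
  by exists 0 => _ [b [y ->]]; case/andP: (p01 b y).
- by move=> a B mB; split; [exact: mp|exact: past_law_push].
Qed.

Theorem theorem4p3 (R : realType) (n : nat)
    (p : 'I_n.+1 -> past n -> R) (P : probability (words int n) R) :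
  transition_family p -> non_null p -> continuous_family p ->
  stationary P -> shift_ergodic P -> atomless P -> invariant_wrt P p ->
  (* (1) *)
  [/\ eta P 0 = 0, eta P n.+1 = 1,
      forall k, (k <= n)%N -> eta P k < eta P k.+1,
      forall a : 'I_n, eta P a.+1 = h P (push (sym a) (allmax n)) /\
                       eta P a.+1 = h P (push (symS a) (allmin n))
    & exists T, continuous_extension P T] /\
  forall T, continuous_extension P T ->
  (forall j, {in branch P j &, {homo T : x y / x < y}}) /\
  (* (2) *)
  [/\ topological_markov (branch P) T,
      lebesgue_invariant (branches P) T,
      lebesgue_ergodic (branches P) T
    & forall b, conditional_prob_version
        [set w | itinerary P T 0 w = b] (future_algebra P T)
        (fun w => p b (fun i => itinerary P T i.+1 w))] /\
  (* (3) *)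
  (forall w, Omega w -> ~ (h P @` @exceptional n) w ->
    deriv_within Omega T w (1 / p (hinv P w 0%N) (drop_last (hinv P w)))) /\
  (* (4) *)
  (forall (a : 'I_n) (z0 : 'I_n.+1) (z : seq 'I_n.+1),
    [/\ h P (below a (z0 :: z)) = h P (above a (z0 :: z)),
        left_deriv T (h P (below a (z0 :: z))) (1 / p z0 (below a z))
      & right_deriv T (h P (below a (z0 :: z))) (1 / p z0 (above a z))]) /\
  (forall a : 'I_n,
    [/\ exists g, branch_extension P T (sym a) g,
        forall g, branch_extension P T (sym a) g ->
          left_deriv g (eta P a.+1) (1 / p (sym a) (allmax n)),
        exists g, branch_extension P T (symS a) g
      & forall g, branch_extension P T (symS a) g ->
          right_deriv g (eta P a.+1) (1 / p (symS a) (allmin n))]) /\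
  (* (5) *)
  (matching p -> piecewise_C1 P T) /\
  (* (6) *)
  (forall rho : R, 0 < rho < 1 ->
    exists2 alpha : R, 0 < alpha <= 1 &
      forall C : R, 0 < C ->
        (forall k, (1 <= k)%N -> continuity_rate p k <= C * rho ^+ k) ->
        matching p -> piecewise_C1_holder P alpha T).
Proof.
move=> ptrans pn pc sP eP aP Pp.
have dis := disintegrated_past_law ptrans pn sP aP Pp.
have unif := continuous_family_unif ptrans pc.
split.
  split.
  - by rewrite /eta eqxx.
  - by rewrite /eta /= eqxx.
  - by move=> k kn; exact: (eta_lt dis (Ordinal (kn : k < n.+1)%N)).
  - move=> a; split; first exact: (eta_max (P := P) (sym a)).
    exact: (eta_min dis (symS a)).
  - exists (T0 P); exact: continuous_extension_T0 dis.
move=> T cT; split; first exact: (extension_increasing dis cT).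
split.
  split.
  - exact: (extension_markov dis cT).
  - exact: (extension_invariant dis cT sP).
  - exact: (extension_ergodic dis cT sP eP).
  - by move=> b; exact: (conditional_prob_future dis cT b sP).
split; first by move=> w Ow Nw; exact: (derivative_Omega dis unif cT Ow Nw).
split; first by move=> a z0 z; exact: (one_sided_derivatives dis unif a z0 z cT).
split.
  move=> a; split.
  - by exists (branch_map P (sym a)); exact: (branch_extension_map dis _ cT).
  - by move=> g; exact: (left_deriv_eta dis unif cT).
  - by exists (branch_map P (symS a)); exact: (branch_extension_map dis _ cT).
  - by move=> g; exact: (right_deriv_eta dis unif cT).
have extE j : {in branch P j, branch_map P j =1 T}.
  by move=> w; rewrite inE => jw; rewrite (extension_branch dis cT jw).
split.
  move=> mat j; exists (branch_map P j), (branch_slope (P := P) (p := p) j).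
  by split; [exact: extE|exact: (branch_C1 dis unif mat)].
set d := inf _ in dis; have d1 := d_lt1 dis.
have d01 : 0 < d < 1 by rewrite pn -subr_gt0.
move=> rho r01; have [alpha a01 ra] := holder_exponent d01 r01.
exists alpha => // C C0 rate mat j.
have /andP[a0 _] := a01; have /andP[r0 r1] := r01.
exists (branch_map P j), (branch_slope (P := P) (p := p) j).
split; [exact: extE|exact: (branch_C1 dis unif mat)|].
(* C + 1 instead of C covers the prefixes of length 0, where only the trivial *)
(* bound 1 is available.                                                      *)
apply: (branch_holder dis mat a0 (ltW r0) ra (B := C + 1)).
  by rewrite addr_ge0// ltW.
move=> [|m] i x y xy.
  by rewrite expr0 mulr1 (le_trans (p_dist_le1 ptrans _ _ _))// lerDr ltW.
apply: (le_trans (p_dist_rate ptrans i xy)); apply: (le_trans (rate _ _)) => //.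
by rewrite ler_wpM2r ?exprn_ge0 ?(ltW r0)// lerDl.
Qed.
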